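(* The following parameterized problems are pairwise $\mathsf{FPT}$-equivalent (i.e., for each ordered pair of them there is an $\mathsf{FPT}$ reduction from the first to the second): \textsc{Grundy Domination}, \textsc{Total Grundy Domination}, \textsc{One-Sided Grundy Total Domination}, \textsc{L-Grundy Domination}, and \textsc{Grundy Covering in Hypergraphs}.
   Context: For a graph $G$ and vertex $v$, $N(v)$ is the open and $N[v]=N(v)\cup\{v\}$ the closed neighborhood. A sequence $(v_1,\dots,v_k)$ of pairwise distinct vertices is: a \emph{dominating sequence} if for each $i$, $N[v_i]\setminus\bigcup_{j<i}N[v_j]\neq\emptyset$; a \emph{total dominating sequence} if $N(v_i)\setminus\bigcup_{j<i}N(v_j)\neq\emptyset$; an \emph{$L$-sequence} if $N[v_i]\setminus\bigcup_{j<i}N(v_j)\neq\emptyset$. \textsc{Grundy Domination}, \textsc{Total Grundy Domination}, \textsc{L-Grundy Domination}: input a graph $G$ and $k$ (parameter $k$), question whether $G$ has a dominating / total dominating / $L$-sequence of length at least $k$. \textsc{One-Sided Grundy Total Domination}: input a bipartite graph $G$ with bipartition $V(G)=A\,\dot\cup\,B$ and $k$ (parameter $k$), question whether there is a total dominating sequence of $G$ of length $k$ containing only vertices of $A$. For a hypergraph $\mathcal{H}=(X,\mathcal{E})$ with $\mathcal{E}\subseteq\mathcal{P}(X)$, a sequence $(C_1,\dots,C_k)$ of edges is a \emph{covering sequence} if $C_i\setminus\bigcup_{j<i}C_j\neq\emptyset$ for all $i$; \textsc{Grundy Covering in Hypergraphs}: input $\mathcal{H}$ and $k$ (parameter $k$),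 question whether $\mathcal{H}$ has a covering sequence of length at least $k$. An $\mathsf{FPT}$ reduction from $L_1$ to $L_2$ maps $(x,k)$ to $(x',k')$ in time $f(k)|x|^{O(1)}$ with $(x,k)\in L_1\iff(x',k')\in L_2$ and $k'\le g(k)$, for computable $f,g$. *)

(* Defs.v *)
(* Parameterized problems are languages of pairs (word, parameter), and running
   times are those of programs of the WHILE language (N. D. Jones,
   "Computability and Complexity from a Programming Perspective"). *)
From mathcomp Require Import all_boot.
Set Implicit Arguments.
Unset Strict Implicit.
Unset Printing Implicit Defensive.

(** * Graphs, hypergraphs and their sequences *)

Record sgraph (T : finType) := SGraph {
  adj :> rel T;
  adj_sym : symmetric adj;
  adj_irr : irreflexive adj
}.

Definition open_nbh (T : finType) (G : sgraph T) (v : T) : {set T} :=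
  [set u | G v u].

Definition closed_nbh (T : finType) (G : sgraph T) (v : T) : {set T} :=
  v |: open_nbh G v.

(* P (s_i) is not contained in the union of the Q (s_j), j < i, for any i *)
Definition footprinting (T U : finType) (P Q : T -> {set U}) (k : nat)
    (s : k.-tuple T) : Prop :=
  forall i : 'I_k,
    P (tnth s i) :\: \bigcup_(j < k | j < i) Q (tnth s j) != set0.

Definition dominating_seq (T : finType) (G : sgraph T) k (s : k.-tuple T) :=
  uniq s /\ footprinting (closed_nbh G) (closed_nbh G) s.

Definition total_dominating_seq (T : finType) (G : sgraph T) k
    (s : k.-tuple T) :=
  uniq s /\ footprinting (open_nbh G) (open_nbh G) s.

Definition L_seq (T : finType) (G : sgraph T) k (s : k.-tuple T) :=
  uniq s /\ footprinting (closed_nbh G) (open_nbh G) s.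

(* A and its complement are the two sides *)
Definition bipartition (T : finType) (G : sgraph T) (A : {set T}) : Prop :=
  forall u v, G u v -> (u \in A) != (v \in A).

Definition covering_seq (X : finType) (E : {set {set X}}) k
    (s : k.-tuple {set X}) :=
  (forall i, tnth s i \in E) /\ footprinting id id s.

(** * Computation: the WHILE language on binary trees *)

Inductive tree := Nil | Cons of tree & tree.

Fixpoint tsize (d : tree) : nat :=
  if d is Cons a b then (tsize a + tsize b).+1 else 1.

Definition thead (d : tree) := if d is Cons a _ then a else Nil.
Definition ttail (d : tree) := if d is Cons _ b then b else Nil.

Inductive expr :=
| EVar of nat
| ENil
| ECons of expr & expr
| EHead of expr
| ETail of expr.

Inductive prog :=
| Assign of nat & expr
| Seq of prog & prog
| If of expr & prog & prog
| While of expr & prog.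

Definition store := nat -> tree.

Definition update (s : store) (x : nat) (d : tree) : store :=
  fun y => if y == x then d else s y.

Fixpoint eval (s : store) (e : expr) : tree :=
  match e with
  | EVar x => s x
  | ENil => Nil
  | ECons a b => Cons (eval s a) (eval s b)
  | EHead a => thead (eval s a)
  | ETail a => ttail (eval s a)
  end.

(* Every operation is charged the full size of its result, as if values were
   copied, so that no value outgrows the time spent.  With unit costs, iterating
   X := cons X X would build trees of exponential size in linear time. *)
Fixpoint ecost (s : store) (e : expr) : nat :=
  tsize (eval s e) +
  match e with
  | EVar _ | ENil => 0
  | ECons a b => ecost s a + ecost s b
  | EHead a | ETail a => ecost s a
  end.

(* exec p s t s' : started in s, the program p halts in s' after time t.
   A test succeeds when its value is not Nil. *)
Inductive exec : prog -> store -> nat -> store -> Prop :=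
| ExecAssign x e s :
    exec (Assign x e) s (ecost s e) (update s x (eval s e))
| ExecSeq p q s1 s2 s3 t1 t2 :
    exec p s1 t1 s2 -> exec q s2 t2 s3 -> exec (Seq p q) s1 (t1 + t2) s3
| ExecIfTrue e p q s s' t :
    eval s e <> Nil -> exec p s t s' -> exec (If e p q) s (ecost s e + t) s'
| ExecIfFalse e p q s s' t :
    eval s e = Nil -> exec q s t s' -> exec (If e p q) s (ecost s e + t) s'
| ExecWhileTrue e p s1 s2 s3 t1 t2 :
    eval s1 e <> Nil -> exec p s1 t1 s2 -> exec (While e p) s2 t2 s3 ->
    exec (While e p) s1 (ecost s1 e + t1 + t2) s3
| ExecWhileFalse e p s :
    eval s e = Nil -> exec (While e p) s (ecost s e) s.

(* variable 0 holds the input and the output *)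
Definition init_store (d : tree) : store := update (fun=> Nil) 0 d.

Definition runs (p : prog) (d : tree) (t : nat) (d' : tree) : Prop :=
  exists2 s, exec p (init_store d) t s & s 0 = d'.

(** * Parameterized problems and FPT reductions *)

Inductive letter := Bit of bool | Sep.

Definition word := seq letter.

Definition tree_of_letter (a : letter) : tree :=
  match a with
  | Bit false => Nil
  | Bit true => Cons Nil Nil
  | Sep => Cons Nil (Cons Nil Nil)
  end.

Definition tree_of_seq (l : seq tree) : tree := foldr Cons Nil l.

Definition tree_of_nat (n : nat) : tree := tree_of_seq (nseq n Nil).

Definition tree_of_instance (x : word) (k : nat) : tree :=
  Cons (tree_of_seq (map tree_of_letter x)) (tree_of_nat k).

Definition computable (f : nat -> nat) : Prop :=
  exists p, forall n, exists t, runs p (tree_of_nat n) t (tree_of_nat (f n)).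

Definition pproblem := word -> nat -> Prop.

(* The time bound is f k * (|x| + 1) ^ c instead of f k * |x| ^ c because the
   latter vanishes at the empty word. *)
Definition fpt_reducible (L1 L2 : pproblem) : Prop :=
  exists (p : prog) (f g : nat -> nat) (c : nat),
    [/\ computable f, computable g &
        forall (x : word) (k : nat), exists (x' : word) (k' t : nat),
          [/\ runs p (tree_of_instance x k) t (tree_of_instance x' k'),
              t <= f k * (size x).+1 ^ c,
              k' <= g k &
              L1 x k <-> L2 x' k']].

(** * The five problems *)

Definition enc_row n (A : pred 'I_n) : word :=
  rcons [seq Bit (A u) | u <- enum 'I_n] Sep.

(* adjacency matrix, row by row *)
Definition enc_graph n (G : sgraph 'I_n) : word :=
  flatten [seq enc_row (G u) | u <- enum 'I_n].

Definition enc_bigraph n (G : sgraph 'I_n) (A : {set 'I_n}) : word :=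
  enc_row (fun u => u \in A) ++ enc_graph G.

(* the ground set in unary, then the incidence vectors of the listed edges *)
Definition enc_hypergraph n (es : seq {set 'I_n}) : word :=
  enc_row (fun _ : 'I_n => true) ++
  flatten [seq enc_row (fun u => u \in C) | C : {set 'I_n} <- es].

Definition grundy_domination : pproblem := fun x k =>
  exists (n : nat) (G : sgraph 'I_n), x = enc_graph G /\
  exists (l : nat) (s : l.-tuple 'I_n), k <= l /\ dominating_seq G s.

Definition total_grundy_domination : pproblem := fun x k =>
  exists (n : nat) (G : sgraph 'I_n), x = enc_graph G /\
  exists (l : nat) (s : l.-tuple 'I_n), k <= l /\ total_dominating_seq G s.

Definition one_sided_grundy_total_domination : pproblem := fun x k =>
  exists (n : nat) (G : sgraph 'I_n) (A : {set 'I_n}),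
  bipartition G A /\ x = enc_bigraph G A /\
  exists s : k.-tuple 'I_n,
    (forall i, tnth s i \in A) /\ total_dominating_seq G s.

Definition L_grundy_domination : pproblem := fun x k =>
  exists (n : nat) (G : sgraph 'I_n), x = enc_graph G /\
  exists (l : nat) (s : l.-tuple 'I_n), k <= l /\ L_seq G s.

(* a set of edges may be listed in any order, possibly with repetitions *)
Definition grundy_covering_in_hypergraphs : pproblem := fun x k =>
  exists (n : nat) (E : {set {set 'I_n}}),
  (exists es : seq {set 'I_n}, E = [set:: es] /\ x = enc_hypergraph es) /\
  exists (l : nat) (s : l.-tuple {set 'I_n}), k <= l /\ covering_seq E s.

Inductive problem_name :=
| GrundyDomination
| TotalGrundyDomination
| OneSidedGrundyTotalDomination
| LGrundyDomination
| GrundyCoveringInHypergraphs.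

Definition problem (P : problem_name) : pproblem :=
  match P with
  | GrundyDomination => grundy_domination
  | TotalGrundyDomination => total_grundy_domination
  | OneSidedGrundyTotalDomination => one_sided_grundy_total_domination
  | LGrundyDomination => L_grundy_domination
  | GrundyCoveringInHypergraphs => grundy_covering_in_hypergraphs
  end.

(* Main.v *)
From mathcomp Require Import all_boot zify.
Require Import Defs.
Set Implicit Arguments.
Unset Strict Implicit.
Unset Printing Implicit Defensive.

(* All five problems ask for long sequences of pairs (v_i, u_i) with u_i in P(v_i)
   and u_i outside Q(v_j) for j < i, and Grundy covering serves as the hub.

   Into Grundy covering: the edges are the closed neighbourhoods, the open ones,
   the open ones of the vertices of A, or, for L-sequences, N[v] + N(v) on two
   disjoint copies of the vertex set.

   Out of Grundy covering: the incidence graph for the one-sided problem; for the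
   three others, a clique on the edges and a clique on the points (two dummies
   each) joined by incidence.  A clique is dominated as soon as c of its vertices
   have been chosen (c = 1 for closed neighbourhoods, 2 for open ones), so a
   sequence longer than 2c yields a covering sequence of the hypergraph or of its
   dual, and reversing the order turns one into the other.  Hence k becomes
   k + 2c.

   Running times: the reductions are composed from operations on trees, each
   realised by a WHILE program of polynomial cost; the class is closed under
   folding over a list when each step enlarges the accumulator by an amount
   bounded polynomially in the other data. *)

(** * Polynomial time on trees *)

(** Polynomials with natural coefficients, generated syntactically. They are monotone and closed
    under composition, so time bounds can be substituted into one another. *)
Inductive pol : (nat -> nat) -> Prop :=
| pol_id : pol (fun n => n)
| pol_const c : pol (fun=> c)
| pol_add f g : pol f -> pol g -> pol (fun n => f n + g n)
| pol_mul f g : pol f -> pol g -> pol (fun n => f n * g n).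

Lemma pol_comp f g : pol f -> pol g -> pol (fun n => f (g n)).
Proof.
move=> pf pg; elim: pf => [|c|f1 f2 _ p1 _ p2|f1 f2 _ p1 _ p2] //.
- exact: pol_const.
- exact: pol_add.
- exact: pol_mul.
Qed.

Lemma pol_mono f m n : pol f -> m <= n -> f m <= f n.
Proof.
by move=> pf le_mn; elim: pf => // f1 f2 _ p1 _ p2;
   [apply: leq_add | apply: leq_mul].
Qed.

(** Separates the parameter from the input length: a polynomial bound in a product becomes a factor
    depending on [m] alone times a fixed power of [n.+1]. *)
Lemma pol_mul_arg f :
  pol f -> exists c, forall m n, f (m * n.+1) <= f m * n.+1 ^ c.
Proof.
elim=> [|c|f1 f2 _ [c1 h1] _ [c2 h2]|f1 f2 _ [c1 h1] _ [c2 h2]].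
- by exists 1.
- by exists 0 => m n; rewrite muln1.
- exists (c1 + c2) => m n; rewrite mulnDl; apply: leq_add.
  + apply: (leq_trans (h1 m n)); rewrite leq_mul2l leq_pexp2l ?orbT //.
    exact: leq_addr.
  + apply: (leq_trans (h2 m n)); rewrite leq_mul2l leq_pexp2l ?orbT //.
    exact: leq_addl.
- by exists (c1 + c2) => m n; rewrite expnD mulnACA; apply: leq_mul.
Qed.

Ltac pol_tac := repeat first
  [ assumption | exact: pol_id | exact: pol_const
  | apply: pol_add | apply: pol_mul
  | match goal with H : pol ?f |- _ => apply: (pol_comp H) end ].

(** * Sizes of computed values *)

Lemma tsize_gt0 d : 0 < tsize d. Proof. by case: d. Qed.

Lemma tsize_thead d : tsize (thead d) <= tsize d.
Proof. by case: d => //= a b; lia. Qed.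

Lemma tsize_ttail d : tsize (ttail d) <= tsize d.
Proof. by case: d => //= a b; lia. Qed.

Lemma tsize_eval_le s e : tsize (eval s e) <= ecost s e.
Proof. by case: e => *; apply: leq_addr. Qed.

(** An assignment costs at least the size of the value it stores, so no variable can grow by more
    than the elapsed time. *)
Lemma exec_tsize p s t s' :
  exec p s t s' -> forall x, tsize (s' x) <= tsize (s x) + t.
Proof.
elim=> {p s t s'} //=.
- move=> x e s y; rewrite /update; case: eqP => _; last lia.
  by have := tsize_eval_le s e; lia.
- by move=> p q s1 s2 s3 t1 t2 _ h1 _ h2 x; have := h1 x; have := h2 x; lia.
- by move=> e p q s s' t _ _ h x; have := h x; lia.
- by move=> e p q s s' t _ _ h x; have := h x; lia.
- by move=> e p s1 s2 s3 t1 t2 _ _ h1 _ h2 x; have := h1 x; have := h2 x; lia.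
- by move=> *; lia.
Qed.

(* The program is given uniformly in a base variable b: it reads its argument
   in b, writes its result there, does not touch the variables below b, and may
   overwrite those above b, whose initial contents are irrelevant. *)
Definition ptime (F : tree -> tree) : Prop :=
  exists (P : nat -> prog) (q : nat -> nat), pol q /\
  forall b s, exists t s',
    [/\ exec (P b) s t s', s' b = F (s b), forall y, y < b -> s' y = s y
      & t <= q (tsize (s b))].

Lemma ptime_ext F G : F =1 G -> ptime F -> ptime G.
Proof.
move=> eFG [P [q [pq h]]]; exists P, q; split=> // b s.
by have [t [s' [e1 e2 e3 e4]]] := h b s; exists t, s'; rewrite -eFG.
Qed.

Lemma ptime_tsize F :
  ptime F -> exists2 q, pol q & forall d, tsize (F d) <= q (tsize d).
Proof.
case=> P [q [pq h]]; exists (fun n => n + q n); first by pol_tac.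
move=> d; have [t [s' [e1 e2 _ e4]]] := h 0 (fun=> d).
by have := exec_tsize e1 0; rewrite e2 /=; move: e4 => /=; lia.
Qed.

(** * Closure under the basic operations *)

Lemma ptime_id : ptime id.
Proof.
exists (fun b => Assign b (EVar b)), (fun n => n); split; first exact: pol_id.
move=> b s; exists (ecost s (EVar b)), (update s b (s b)); split => /=.
- exact: (ExecAssign b (EVar b) s).
- by rewrite /update eqxx.
- by move=> y lt_y; rewrite /update; case: eqP => //; lia.
- by rewrite addn0.
Qed.

Lemma ptime_nil : ptime (fun=> Nil).
Proof.
exists (fun b => Assign b ENil), (fun n => n); split; first exact: pol_id.
move=> b s; exists (ecost s ENil), (update s b Nil); split => /=.
- exact: (ExecAssign b ENil s).
- by rewrite /update eqxx.
- by move=> y lt_y; rewrite /update; case: eqP => //; lia.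
- exact: tsize_gt0.
Qed.

Lemma ptime_comp F G : ptime G -> ptime F -> ptime (fun d => G (F d)).
Proof.
move=> [Q [q [pq hG]]] pF; have [r pr hr] := ptime_tsize pF.
case: pF => P [p [pp hF]].
exists (fun b => Seq (P b) (Q b)), (fun n => p n + q (r n)).
split; first by pol_tac.
move=> b s; have [t [s' [e1 e2 e3 e4]]] := hF b s.
have [t' [s'' [f1 f2 f3 f4]]] := hG b s'.
exists (t + t'), s''; split.
- exact: ExecSeq e1 f1.
- by rewrite f2 e2.
- by move=> y lt_y; rewrite f3 ?e3.
- by apply: leq_add => //; apply: leq_trans f4 (pol_mono _ _) => //; rewrite e2.
Qed.

Lemma ptime_thead F : ptime F -> ptime (fun d => thead (F d)).
Proof.
apply: ptime_comp; exists (fun b => Assign b (EHead (EVar b))), (fun n => n + n).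
split; first by pol_tac.
move=> b s; exists (ecost s (EHead (EVar b))), (update s b (thead (s b))).
split=> /=.
- exact: (ExecAssign b (EHead (EVar b)) s).
- by rewrite /update eqxx.
- by move=> y lt_y; rewrite /update; case: eqP => //; lia.
- by rewrite addn0 leq_add2r tsize_thead.
Qed.

Lemma ptime_ttail F : ptime F -> ptime (fun d => ttail (F d)).
Proof.
apply: ptime_comp; exists (fun b => Assign b (ETail (EVar b))), (fun n => n + n).
split; first by pol_tac.
move=> b s; exists (ecost s (ETail (EVar b))), (update s b (ttail (s b))).
split=> /=.
- exact: (ExecAssign b (ETail (EVar b)) s).
- by rewrite /update eqxx.
- by move=> y lt_y; rewrite /update; case: eqP => //; lia.
- by rewrite addn0 leq_add2r tsize_ttail.
Qed.

(** Working on a copy in a higher variable keeps the argument available for later use when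
    [a < b]. *)
Lemma ptime_copy F : ptime F ->
  exists (P : nat -> nat -> prog) (q : nat -> nat), pol q /\
  forall a b s, exists t s',
    [/\ exec (P a b) s t s', s' b = F (s a), forall y, y < b -> s' y = s y
      & t <= q (tsize (s a))].
Proof.
case=> P [q [pq h]].
exists (fun a b => Seq (Assign b (EVar a)) (P b)), (fun n => n + q n).
split; first by pol_tac.
move=> a b s; have [t [s' [e1 e2 e3 e4]]] := h b (update s b (s a)).
exists (ecost s (EVar a) + t), s'; move: e2 e4; rewrite /update eqxx => e2 e4.
split=> //.
- exact: ExecSeq (ExecAssign b (EVar a) s) e1.
- by move=> y lt_y; rewrite e3 // /update; case: eqP => //; lia.
- by rewrite /= addn0; apply: leq_add.
Qed.

Lemma ptime_cons F G :
  ptime F -> ptime G -> ptime (fun d => Cons (F d) (G d)).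
Proof.
move=> pF pG; have [r1 pr1 hr1] := ptime_tsize pF.
have [r2 pr2 hr2] := ptime_tsize pG.
have [P [p [pp hP]]] := ptime_copy pF; have [Q [q [pq hQ]]] := ptime_copy pG.
(* The second program starts at base [b.+2], hence leaves alone both the argument in [b] and the
   first result in [b.+1]. *)
exists (fun b => Seq (P b b.+1) (Seq (Q b b.+2)
  (Assign b (ECons (EVar b.+1) (EVar b.+2))))),
  (fun n => p n + (q n + (2 * (r1 n + r2 n) + 1))).
split; first by pol_tac.
move=> b s; have [t1 [s1 [e1 e2 e3 e4]]] := hP b b.+1 s.
have [t2 [s2 [f1 f2 f3 f4]]] := hQ b b.+2 s1.
have s1b : s1 b = s b by apply: e3.
have s2b : s2 b.+1 = F (s b) by rewrite f3.
rewrite s1b in f2 f4.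
eexists; eexists; split.
- apply: ExecSeq e1 _; apply: ExecSeq f1 _; exact: ExecAssign.
- by rewrite /update eqxx /= s2b f2.
- by move=> y lt_y; rewrite /update; case: eqP => [|_]; [lia|rewrite f3 ?e3 //; lia].
- rewrite /= s2b f2; have := hr1 (s b); have := hr2 (s b); lia.
Qed.

Definition nonnil (d : tree) : bool := if d is Nil then false else true.

Lemma nonnilP d : reflect (d <> Nil) (nonnil d).
Proof. by case: d => [|a b]; constructor. Qed.

Lemma ptime_if_nonnil C F G : ptime C -> ptime F -> ptime G ->
  ptime (fun d => if nonnil (C d) then F d else G d).
Proof.
move=> pC [P [p [pp hP]]] [Q [q [pq hQ]]]; have [r pr hr] := ptime_tsize pC.
have [T [m [pm hT]]] := ptime_copy pC.
exists (fun b => Seq (T b b.+1) (If (EVar b.+1) (P b) (Q b))),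
  (fun n => m n + (r n + (p n + q n))).
split; first by pol_tac.
move=> b s; have [t1 [s1 [e1 e2 e3 e4]]] := hT b b.+1 s.
have s1b : s1 b = s b by apply: e3.
have := hr (s b); case: nonnilP => hC hrb.
- have [t2 [s2 [f1 f2 f3 f4]]] := hP b s1; rewrite s1b in f2 f4.
  eexists; exists s2; split.
  + by apply: ExecSeq e1 _; apply: ExecIfTrue f1; rewrite /= e2.
  + exact: f2.
  + by move=> y lt_y; rewrite f3 ?e3 //; lia.
  + by rewrite /= e2; lia.
- have [t2 [s2 [f1 f2 f3 f4]]] := hQ b s1; rewrite s1b in f2 f4.
  eexists; exists s2; split.
  + apply: ExecSeq e1 _; apply: ExecIfFalse f1.
    by rewrite /= e2; case: (C _) hC => // ? ? [].
  + exact: f2.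
  + by move=> y lt_y; rewrite f3 ?e3 //; lia.
  + by rewrite /= e2; lia.
Qed.

(** * Trees as lists, and iteration along a list *)

Fixpoint tlist (d : tree) : seq tree :=
  if d is Cons a b then a :: tlist b else [::].

Lemma tlistK : cancel tlist tree_of_seq.
Proof. by elim=> //= a _ b ->. Qed.

Lemma tree_of_seqK : cancel tree_of_seq tlist.
Proof. by elim=> //= a l ->. Qed.

Lemma size_tlist d : size (tlist d) <= tsize d.
Proof. by elim: d => //= a _ b; lia. Qed.

Lemma tsize_tree_of_seq l : tsize (tree_of_seq l) = (sumn (map tsize l) + size l).+1.
Proof. by elim: l => //= a l ->; lia. Qed.

(** The loop keeps the argument in [b], the remaining list in [b.+1] and the accumulator in [b.+2],
    and evaluates [G] at base [b.+3]. The growth of the accumulator per step is bounded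
    independently of the accumulator itself; iterating an arbitrary polynomial growth could be
    exponential. *)
Lemma ptime_fold (L I : tree -> tree) (G : tree -> tree -> tree -> tree) :
  ptime L -> ptime I ->
  ptime (fun e => G (thead e) (thead (ttail e)) (ttail (ttail e))) ->
  (exists2 r, pol r &
     forall x a d, tsize (G x a d) <= tsize a + r (tsize x + tsize d)) ->
  ptime (fun d => foldl (fun a x => G x a d) (I d) (tlist (L d))).
Proof.
move=> pL pI [Q [q [pq hQ]]] [r pr hr].
have [l pl hl] := ptime_tsize pL; have [i pi hi] := ptime_tsize pI.
have [P1 [p1 [pp1 hP1]]] := ptime_copy pL.
have [P2 [p2 [pp2 hP2]]] := ptime_copy pI.
pose body b := Seq
  (Assign b.+3 (ECons (EHead (EVar b.+1)) (ECons (EVar b.+2) (EVar b))))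
  (Seq (Q b.+3) (Seq (Assign b.+2 (EVar b.+3))
                     (Assign b.+1 (ETail (EVar b.+1))))).
(* bound on the size of the accumulator *)
pose B n := i n + l n * r (l n + n).
(* Time of one iteration: the loop test, the construction of the triple, the run of [Q] on it, and
   the two assignments that store the new accumulator and the rest of the list. *)
pose step n := l n + (5 * l n + 4 * B n + 3 * n + 10) +
               q (l n + B n + n + 2) + B n + 2 * l n.
exists (fun b => Seq (P1 b b.+1) (Seq (P2 b b.+2)
  (Seq (While (EVar b.+1) (body b)) (Assign b (EVar b.+2))))),
  (fun n => p1 n + (p2 n + (l n * step n + l n + B n))).
split; first by rewrite /step /B; pol_tac.
move=> b s; set d := s b; set N := tsize d.
have [t1 [s1 [e1 e2 e3 e4]]] := hP1 b b.+1 s.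
have [t2 [s2 [f1 f2 f3 f4]]] := hP2 b b.+2 s1.
have s1b : s1 b = d by apply: e3.
have s2b : s2 b = d by rewrite f3 // s1b.
have s2L : s2 b.+1 = L d by rewrite f3.
rewrite s1b in f2 f4.
(* Invariant: the accumulator together with the increments of the [m] iterations still to come stays
   within [B N]. *)
have loop m : forall s, s b = d -> tsize (s b.+1) <= l N ->
    size (tlist (s b.+1)) = m ->
    tsize (s b.+2) + m * r (l N + N) <= B N ->
  exists t s', [/\ exec (While (EVar b.+1) (body b)) s t s',
    s' b.+2 = foldl (fun a x => G x a d) (s b.+2) (tlist (s b.+1)),
    forall y, y < b -> s' y = s y, t <= m * step N + l N &
    tsize (s' b.+2) <= B N].
  elim: m => [|m IH] {s1 e1 e2 e3 s1b f1 f2 f3 s2b s2L s2 e4 f4} u ub uL sz uB.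
    have uN : u b.+1 = Nil by case: (u b.+1) sz.
    exists (ecost u (EVar b.+1)), u; split=> //.
    - exact: ExecWhileFalse.
    - by rewrite uN.
    - by rewrite /= addn0 mul0n.
    - by lia.
  case Eu : (u b.+1) sz uL => [|x w] //= [sz] uL.
  set u1 := update u b.+3 (Cons x (Cons (u b.+2) d)).
  have [t [u2 [g1 g2 g3 g4]]] := hQ b.+3 u1.
  have u1b : u1 b.+3 = Cons x (Cons (u b.+2) d) by rewrite /u1 /update eqxx.
  rewrite u1b /= in g2 g4.
  set v := update u2 b.+2 (u2 b.+3); set u3 := update v b.+1 (ttail (v b.+1)).
  have u21 : u2 b.+1 = Cons x w.
    by rewrite g3 // /u1 /update; case: eqP => [|_]; [lia | rewrite Eu].
  have u2b : u2 b = d.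
    by rewrite g3 ?/u1 /update; last lia; case: eqP => [|_]; [lia | rewrite ub].
  have v1 : v b.+1 = Cons x w.
    by rewrite /v /update; case: eqP; first lia.
  have u3b : u3 b = d by rewrite /u3 /v /update; do 2 (case: eqP; first lia).
  have u31 : u3 b.+1 = w by rewrite /u3 /update eqxx v1.
  have u32 : u3 b.+2 = G x (u b.+2) d.
    by rewrite /u3 /v /update eqxx g2; case: eqP; first lia.
  have Gx : tsize (G x (u b.+2) d) <= tsize (u b.+2) + r (l N + N).
    apply: leq_trans (hr _ _ _) _; rewrite leq_add2l; apply: pol_mono => //.
    by rewrite leq_add2r; lia.
  have [t' [u4 [k1 k2 k3 k4 k5]]] : exists t s', [/\
      exec (While (EVar b.+1) (body b)) u3 t s',
      s' b.+2 = foldl (fun a x => G x a d) (u3 b.+2) (tlist (u3 b.+1)),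
      forall y, y < b -> s' y = u3 y, t <= m * step N + l N &
      tsize (s' b.+2) <= B N].
    apply: IH => //; rewrite ?u31 //; first by lia.
    by rewrite u32; move: uB; rewrite mulSn; lia.
  eexists; exists u4; split.
  - apply: ExecWhileTrue k1; first by rewrite /= Eu.
    apply: ExecSeq; first exact: ExecAssign.
    rewrite /= Eu ub /= -/u1; apply: ExecSeq g1 _.
    apply: ExecSeq; exact: ExecAssign.
  - by rewrite k2 u31 u32.
  - move=> y lt_y; rewrite k3 // /u3 /v /update; do 2 (case: eqP; first lia).
    move=> _ _; rewrite g3 ?/u1 /update; last lia.
    by case: eqP; first lia.
  - have tq : t <= q (l N + B N + N + 2).
      apply: leq_trans g4 (pol_mono _ _) => //.
      by rewrite -/N; lia.
    rewrite /= -/v Eu ub v1 /= g2 -/N; rewrite mulSn {1}/step; lia.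
  - exact: k5.
have [t3 [s3 [k1 k2 k3 k4 k5]]] : exists t s', [/\
    exec (While (EVar b.+1) (body b)) s2 t s',
    s' b.+2 = foldl (fun a x => G x a d) (s2 b.+2) (tlist (s2 b.+1)),
    forall y, y < b -> s' y = s2 y,
    t <= size (tlist (s2 b.+1)) * step N + l N & tsize (s' b.+2) <= B N].
  apply: loop => //; first by rewrite s2L; apply: hl.
  rewrite f2 s2L; apply: leq_add; first exact: hi.
  by rewrite leq_mul2r (leq_trans (size_tlist _) (hl _)) orbT.
eexists; eexists; split.
- apply: ExecSeq e1 _; apply: ExecSeq f1 _; apply: ExecSeq k1 _.
  exact: ExecAssign.
- by rewrite /update eqxx /= k2 f2 s2L.
- move=> y lt_y; rewrite /update; case: eqP => [|_]; first lia.
  by rewrite k3 // f3 ?e3 //; lia.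
- have : size (tlist (s2 b.+1)) * step N <= l N * step N.
    by rewrite s2L leq_mul2r (leq_trans (size_tlist _) (hl _)) orbT.
  move: e4 f4; rewrite /= -/d -/N addn0; lia.
Qed.

(** * Booleans, unary numbers and lists in polynomial time *)

Definition tsz (d : tree) : nat := size (tlist d).
Definition tbool (b : bool) : tree := if b then Cons Nil Nil else Nil.
(** The output is in unary, so the values are polynomially bounded and a number can itself serve as
    the list that drives a fold. *)
Definition nptime (f : tree -> nat) := ptime (fun d => tree_of_nat (f d)).
Definition bptime (P : tree -> bool) := ptime (fun d => tbool (P d)).

Lemma nonnil_tbool b : nonnil (tbool b) = b. Proof. by case: b. Qed.

Lemma tsz_nat n : tsz (tree_of_nat n) = n.
Proof. by rewrite /tsz /tree_of_nat tree_of_seqK size_nseq. Qed.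

Lemma tsize_nat n : tsize (tree_of_nat n) = n.*2.+1.
Proof.
by rewrite /tree_of_nat tsize_tree_of_seq size_nseq map_nseq sumn_nseq /=; lia.
Qed.

Lemma tsz_tsize d : (tsz d).*2 < tsize d.
Proof. by elim: d => //= a _ b; rewrite /tsz /=; have := tsize_gt0 a; lia. Qed.

Lemma nptime_bound f :
  nptime f -> exists2 q, pol q & forall d, f d <= q (tsize d).
Proof.
case/ptime_tsize => q pq h; exists q => // d.
by have := h d; rewrite tsize_nat; lia.
Qed.

Lemma ptime_const c : ptime (fun=> c).
Proof. by elim: c => [|a ha b hb]; [exact: ptime_nil | exact: ptime_cons]. Qed.

Lemma bptime_nonnil F : ptime F -> bptime (fun d => nonnil (F d)).
Proof.
move=> pF; apply: ptime_ext (ptime_if_nonnil pF (ptime_const (tbool true))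
  (ptime_const Nil)) => d; by case: nonnil.
Qed.

Lemma ptime_if P F G : bptime P -> ptime F -> ptime G ->
  ptime (fun d => if P d then F d else G d).
Proof.
move=> pP pF pG; apply: ptime_ext (ptime_if_nonnil pP pF pG) => d.
by rewrite nonnil_tbool.
Qed.

Lemma bptime_if P Q S : bptime P -> bptime Q -> bptime S ->
  bptime (fun d => if P d then Q d else S d).
Proof.
by move=> pP pQ pS; apply: ptime_ext (ptime_if pP pQ pS) => d; case: (P d).
Qed.

Lemma bptime_const b : bptime (fun=> b). Proof. exact: ptime_const. Qed.

Lemma bptime_neg P : bptime P -> bptime (fun d => ~~ P d).
Proof.
by move=> pP; apply: bptime_if pP (bptime_const _) (bptime_const _).
Qed.

Lemma bptime_and P Q : bptime P -> bptime Q -> bptime (fun d => P d && Q d).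
Proof. by move=> pP pQ; apply: bptime_if pP pQ (bptime_const _). Qed.

Lemma bptime_or P Q : bptime P -> bptime Q -> bptime (fun d => P d || Q d).
Proof. by move=> pP pQ; apply: bptime_if pP (bptime_const _) pQ. Qed.

Lemma bptime_imply P Q : bptime P -> bptime Q -> bptime (fun d => P d ==> Q d).
Proof. by move=> pP pQ; apply: bptime_if pP pQ (bptime_const _). Qed.

Lemma bptime_eqb P Q : bptime P -> bptime Q -> bptime (fun d => P d == Q d).
Proof.
move=> pP pQ; apply: ptime_ext (bptime_if pP pQ (bptime_neg pQ)) => d.
by case: (P d); case: (Q d).
Qed.

Lemma nptime_const c : nptime (fun=> c). Proof. exact: ptime_const. Qed.

Lemma nptime_succ f : nptime f -> nptime (fun d => (f d).+1).
Proof. exact: ptime_cons ptime_nil. Qed.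

Lemma foldl_succ (T : Type) (l : seq T) n :
  foldl (fun a _ => Cons Nil a) (tree_of_nat n) l = tree_of_nat (size l + n).
Proof. by elim: l n => //= x l IH n; rewrite (IH n.+1) addnS. Qed.

Lemma nptime_tsz_add F g :
  ptime F -> nptime g -> nptime (fun d => tsz (F d) + g d).
Proof.
move=> pF pg; apply: ptime_ext (ptime_fold (G := fun _ a _ => Cons Nil a) pF pg
  _ _) => [d||].
- by rewrite foldl_succ.
- exact: ptime_cons ptime_nil (ptime_thead (ptime_ttail ptime_id)).
- by exists (fun=> 2) => [|x a d /=]; [exact: pol_const | lia].
Qed.

Lemma nptime_tsz F : ptime F -> nptime (fun d => tsz (F d)).
Proof.
move=> pF; apply: ptime_ext (nptime_tsz_add pF (nptime_const 0)) => d.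
by rewrite addn0.
Qed.

Lemma nptime_add f g : nptime f -> nptime g -> nptime (fun d => f d + g d).
Proof.
move=> pf pg; apply: ptime_ext (nptime_tsz_add pf pg) => d.
by rewrite tsz_nat.
Qed.

Lemma foldl_ttail (l : seq tree) d :
  foldl (fun a _ => ttail a) d l = tree_of_seq (drop (size l) (tlist d)).
Proof.
elim: l d => [|x l IH] d /=; first by rewrite drop0 tlistK.
by rewrite IH; case: d.
Qed.

Lemma ptime_drop F n : ptime F -> nptime n ->
  ptime (fun d => tree_of_seq (drop (n d) (tlist (F d)))).
Proof.
move=> pF pn; apply: ptime_ext (ptime_fold (G := fun _ a _ => ttail a) pn pF
  _ _) => [d||].
- by rewrite foldl_ttail -/(tsz _) tsz_nat.
- exact: ptime_ttail (ptime_thead (ptime_ttail ptime_id)).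
- by exists (fun=> 2) => [|x a d /=]; [exact: pol_const |];
    have := tsize_ttail a; lia.
Qed.

Lemma ptime_nth F n : ptime F -> nptime n ->
  ptime (fun d => nth Nil (tlist (F d)) (n d)).
Proof.
move=> pF pn; apply: ptime_ext (ptime_thead (ptime_drop pF pn)) => d.
by elim: (tlist _) (n d) => [|x l IH] [|m] //=; rewrite drop0.
Qed.

Lemma nptime_sub f g : nptime f -> nptime g -> nptime (fun d => f d - g d).
Proof.
move=> pf pg; apply: ptime_ext (ptime_drop pf pg) => d.
by rewrite /tree_of_nat tree_of_seqK drop_nseq.
Qed.

Lemma bptime_leq f g : nptime f -> nptime g -> bptime (fun d => f d <= g d).
Proof.
move=> pf pg.
apply: ptime_ext (bptime_neg (bptime_nonnil (nptime_sub pf pg))) => d.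
by rewrite -subn_eq0; case: (f d - g d).
Qed.

Lemma bptime_eqn f g : nptime f -> nptime g -> bptime (fun d => f d == g d).
Proof.
move=> pf pg.
apply: ptime_ext (bptime_and (bptime_leq pf pg) (bptime_leq pg pf)) => d.
by rewrite eqn_leq.
Qed.

Lemma nptime_mul f g : nptime f -> nptime g -> nptime (fun d => f d * g d).
Proof.
move=> pf pg; apply: ptime_ext (ptime_fold
  (G := fun _ a d => tree_of_nat (tsz a + g d)) pf ptime_nil _ _) => [d||].
- rewrite -[f d in RHS]tsz_nat /tsz.
  have: forall l : seq tree, forall n, foldl (fun a _ => tree_of_nat (tsz a + g d))
    (tree_of_nat n) l = tree_of_nat (n + size l * g d).
    by elim=> [|x l IH] n /=; rewrite ?addn0 // tsz_nat IH mulSn addnA.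
  by move/(_ _ 0).
- exact: nptime_tsz_add (ptime_thead (ptime_ttail ptime_id))
    (ptime_comp pg (ptime_ttail (ptime_ttail ptime_id))).
- have [q pq hq] := nptime_bound pg.
  exists (fun n => 2 * q n) => [|x a d]; first by pol_tac.
  rewrite tsize_nat; have := tsz_tsize a; have := hq d.
  have : q (tsize d) <= q (tsize x + tsize d) by apply: pol_mono => //; lia.
  lia.
Qed.

Lemma foldl_cons (l : seq tree) a :
  foldl (fun a x => Cons x a) a l = tree_of_seq (catrev l (tlist a)).
Proof. by elim: l a => [|x l IH] a /=; rewrite ?tlistK ?IH. Qed.

Lemma ptime_catrev F G : ptime F -> ptime G ->
  ptime (fun d => tree_of_seq (catrev (tlist (F d)) (tlist (G d)))).
Proof.
move=> pF pG; apply: ptime_ext (ptime_fold (G := fun x a _ => Cons x a) pF pG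
  _ _) => [d||].
- by rewrite foldl_cons.
- exact: ptime_cons (ptime_thead ptime_id) (ptime_thead (ptime_ttail ptime_id)).
- by exists (fun n => n + 1) => [|x a d /=]; [pol_tac | lia].
Qed.

Lemma ptime_rev F : ptime F -> ptime (fun d => tree_of_seq (rev (tlist (F d)))).
Proof. by move=> pF; apply: ptime_catrev pF ptime_nil. Qed.

Lemma ptime_cat F G : ptime F -> ptime G ->
  ptime (fun d => tree_of_seq (tlist (F d) ++ tlist (G d))).
Proof.
move=> pF pG; apply: ptime_ext (ptime_catrev (ptime_rev pF) pG) => d.
by rewrite tree_of_seqK catrevE revK.
Qed.

Lemma ptime_map (L : tree -> tree) (F : tree -> tree -> tree) :
  ptime L -> ptime (fun e => F (thead e) (ttail e)) ->
  ptime (fun d => tree_of_seq [seq F x d | x <- tlist (L d)]).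
Proof.
move=> pL pF.
have := ptime_rev (ptime_fold (G := fun x a d => Cons (F x d) a) pL ptime_nil _ _).
move=> h; apply: ptime_ext (h _ _) => {h} [d||].
- have -> a l : foldl (fun a x => Cons (F x d) a) a l =
     foldl (fun a x => Cons x a) a [seq F x d | x <- l].
    by elim: l a => //= x l IH a.
  by rewrite foldl_cons tree_of_seqK revK.
- apply: ptime_cons; last exact: ptime_thead (ptime_ttail ptime_id).
  apply: ptime_comp pF (ptime_cons (ptime_thead ptime_id) _).
  exact: ptime_ttail (ptime_ttail ptime_id).
- have [q pq hq] := ptime_tsize pF.
  exists (fun n => q (n + 1) + 1) => [|x a d]; first by pol_tac.
  by have := hq (Cons x d); rewrite /= !addn1; lia.
Qed.

(** The list is built from its end: the length of the accumulator determines the number to be put in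
    front next. *)
Lemma ptime_iota n : nptime n ->
  ptime (fun d => tree_of_seq [seq tree_of_nat i | i <- iota 0 (n d)]).
Proof.
move=> pn; apply: ptime_ext (ptime_fold
  (G := fun _ a d => Cons (tree_of_nat (n d - (tsz a).+1)) a) pn ptime_nil _ _)
  => [d||].
- have: forall (l : seq tree) m, size l + m <= n d ->
    foldl (fun a _ => Cons (tree_of_nat (n d - (tsz a).+1)) a)
      (tree_of_seq [seq tree_of_nat i | i <- iota (n d - m) m]) l =
    tree_of_seq [seq tree_of_nat i | i <- iota (n d - (size l + m)) (size l + m)].
    elim=> [//|x l IH] m le_m.
    rewrite [size (x :: l)]/= addSnnS -IH; last by move: le_m => /=; lia.
    rewrite [foldl _ _ (x :: l)]/= /tsz tree_of_seqK size_map size_iota.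
    by rewrite /= -subSn ?subSS //; move: le_m => /=; lia.
  move/(_ (tlist (tree_of_nat (n d))) 0); rewrite addn0 -/(tsz _) tsz_nat subnn.
  by move=> -> //.
- apply: ptime_cons; last exact: ptime_thead (ptime_ttail ptime_id).
  exact: nptime_sub (ptime_comp pn (ptime_ttail (ptime_ttail ptime_id)))
    (nptime_succ (nptime_tsz (ptime_thead (ptime_ttail ptime_id)))).
- have [q pq hq] := nptime_bound pn.
  exists (fun n => 2 * q n + 2) => [|x a d /=]; first by pol_tac.
  rewrite tsize_nat; have := hq d.
  have : q (tsize d) <= q (tsize x + tsize d) by apply: pol_mono => //; lia.
  lia.
Qed.

(** The index reaches the body as a unary numeral consed onto the environment, so nested loops find
    their indices innermost first. *)
Lemma ptime_map_iota (n : tree -> nat) (F : nat -> tree -> tree) :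
  nptime n -> ptime (fun e => F (tsz (thead e)) (ttail e)) ->
  ptime (fun d => tree_of_seq [seq F i d | i <- iota 0 (n d)]).
Proof.
move=> pn pF; have := ptime_map (F := fun x => F (tsz x)) (ptime_iota pn) pF.
apply: ptime_ext => d; rewrite tree_of_seqK -map_comp.
by congr tree_of_seq; apply: eq_map => i /=; rewrite tsz_nat.
Qed.

Lemma bptime_all_iota (n : tree -> nat) (P : nat -> tree -> bool) :
  nptime n -> bptime (fun e => P (tsz (thead e)) (ttail e)) ->
  bptime (fun d => all (fun i => P i d) (iota 0 (n d))).
Proof.
move=> pn pP; apply: ptime_ext (ptime_fold
  (G := fun x a _ => if nonnil x then a else Nil)
  (ptime_map_iota (F := fun i d => tbool (P i d)) pn pP)
  (ptime_const (tbool true)) _ _) => [d||].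
- rewrite tree_of_seqK; elim: (iota _ _) => //= i l IH.
  rewrite nonnil_tbool; case: (P i d) => //=.
  by elim: l {IH} => //= j l; case: nonnil.
- apply: ptime_if_nonnil (ptime_thead ptime_id) _ ptime_nil.
  exact: ptime_thead (ptime_ttail ptime_id).
- by exists (fun=> 1) => [|x a d]; [exact: pol_const | case: nonnil => /=; lia].
Qed.

Lemma pol_nptime f g : pol f -> nptime g -> nptime (fun d => f (g d)).
Proof.
move=> pf pg; elim: pf => [//|c|f1 f2 _ p1 _ p2|f1 f2 _ p1 _ p2].
- exact: nptime_const.
- exact: nptime_add p1 p2.
- exact: nptime_mul p1 p2.
Qed.

(** * From functions on trees to FPT reductions *)

Lemma ptime_runs F : ptime F -> exists p q, pol q /\
  forall d, exists2 t, runs p d t (F d) & t <= q (tsize d).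
Proof.
case=> P [q [pq h]]; exists (P 0), q; split=> // d.
have [t [s [e1 e2 _ e4]]] := h 0 (init_store d).
by exists t => //; exists s.
Qed.

Lemma pol_computable f : pol f -> computable f.
Proof.
move=> pf; have [p [q [_ h]]] := ptime_runs (pol_nptime pf (nptime_tsz ptime_id)).
by exists p => n; have [t r _] := h (tree_of_nat n); exists t; rewrite tsz_nat in r.
Qed.

(** A strengthening of [fpt_reducible] with polynomial time in the whole instance and polynomial
    growth of the parameter; it composes directly, which the passage through the hub requires. *)
Definition poly_reducible (L1 L2 : pproblem) : Prop :=
  exists (F : tree -> tree) (g : nat -> nat), [/\ ptime F, pol g &
    forall x k, exists x' k', [/\ F (tree_of_instance x k) = tree_of_instance x' k',
      k' <= g k & L1 x k <-> L2 x' k']].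

Lemma poly_reducible_refl L : poly_reducible L L.
Proof.
exists id, (fun n => n); split; [exact: ptime_id | exact: pol_id |].
by move=> x k; exists x, k.
Qed.

Lemma poly_reducible_trans L1 L2 L3 :
  poly_reducible L1 L2 -> poly_reducible L2 L3 -> poly_reducible L1 L3.
Proof.
move=> [F [f [pF pf h1]]] [G [g [pG pg h2]]].
exists (fun d => G (F d)), (fun n => g (f n)); split.
- exact: ptime_comp pG pF.
- exact: pol_comp pg pf.
move=> x k; have [x1 [k1 [e1 l1 i1]]] := h1 x k.
have [x2 [k2 [e2 l2 i2]]] := h2 x1 k1; exists x2, k2; split.
- by rewrite e1 e2.
- exact: leq_trans l2 (pol_mono pg l1).
- exact: iff_trans i1 i2.
Qed.

(** A letter is a tree of size at most 5. The bound is given as a product to fit [pol_mul_arg]. *)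
Lemma tsize_instance x k :
  tsize (tree_of_instance x k) <= (6 * k + 6) * (size x).+1.
Proof.
rewrite /tree_of_instance /= tsize_nat tsize_tree_of_seq size_map -map_comp.
set S := sumn _; have : S <= 5 * size x.
  by rewrite {}/S; elim: x => //= a x IH; case: a => [[]|] /=; lia.
by rewrite mulnS mulnDl; move: (6 * k * size x) => z; lia.
Qed.

Lemma poly_fpt_reducible L1 L2 : poly_reducible L1 L2 -> fpt_reducible L1 L2.
Proof.
move=> [F [g [pF pg h]]]; have [p [q [pq hq]]] := ptime_runs pF.
have [c hc] := pol_mul_arg pq.
exists p, (fun k => q (6 * k + 6)), g, c; split.
- by apply: pol_computable; pol_tac.
- exact: pol_computable.
move=> x k; have [x' [k' [e l i]]] := h x k.
have [t r b] := hq (tree_of_instance x k).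
exists x', k', t; split=> //; first by rewrite -e.
by apply: leq_trans b (leq_trans (pol_mono pq (tsize_instance x k)) (hc _ _)).
Qed.

(** * Words as boolean matrices *)

Implicit Types R : seq (seq bool).

Definition enc_rows R : word := flatten [seq rcons (map Bit r) Sep | r <- R].

(** The word is read from the right: a separator opens a row, a bit goes to the front of the current
    row, and a bit with no separator to its right is dropped. *)
Definition parse_step (a : letter) R : seq (seq bool) :=
  match a, R with
  | Sep, _ => [::] :: R
  | Bit b, r :: R' => (b :: r) :: R'
  | Bit _, [::] => [::]
  end.

Definition parse (x : word) : seq (seq bool) := foldr parse_step [::] x.

Definition is_sep (a : letter) := if a is Sep then true else false.

(** The default [Sep] of [last] admits the empty word, which encodes the matrix without rows. With
    [wf_enc_rows], the last letter decides whether a word encodes a matrix; its rows may differ in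
    length. *)
Lemma parseK x : is_sep (last Sep x) -> enc_rows (parse x) = x.
Proof.
elim: x => // a [|a' x] IH wf; first by case: a wf.
move: (IH wf); rewrite -[parse (a :: _)]/(parse_step a (parse (a' :: x))).
by case: (parse _) => [|r R] // <-; case: a {IH wf}.
Qed.

Lemma enc_rowsK : cancel enc_rows parse.
Proof.
move=> R; elim: R => //= r R IH; rewrite /enc_rows /= /parse.
rewrite foldr_cat -[foldr _ _ (flatten _)]/(parse (enc_rows R)) IH.
by elim: r => //= b r ->.
Qed.

Lemma wf_enc_rows R : is_sep (last Sep (enc_rows R)).
Proof.
rewrite /enc_rows; elim/last_ind: R => // R r _.
by rewrite map_rcons flatten_rcons last_cat last_rcons.
Qed.

(** * Matrices as trees *)

Definition trows R : tree :=
  tree_of_seq [seq tree_of_seq [seq tbool b | b <- r] | r <- R].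

Definition rows_of (d : tree) : seq (seq bool) :=
  [seq [seq nonnil t | t <- tlist r] | r <- tlist d].

Lemma trowsK : cancel trows rows_of.
Proof.
move=> R; rewrite /rows_of /trows tree_of_seqK -map_comp map_id_in // => r _ /=.
rewrite tree_of_seqK -map_comp map_id_in // => b _ /=; exact: nonnil_tbool.
Qed.

Definition tword (x : word) : tree := tree_of_seq (map tree_of_letter x).

(** Among the letters only [Sep] has a non-nil tail, and the tree of a bit is already its [tbool],
    so it can be consed onto the row unchanged. *)
Definition tparse_step (x a : tree) : tree :=
  if nonnil (ttail x) then Cons Nil a else
  if nonnil a then Cons (Cons x (thead a)) (ttail a) else Nil.

Definition tparse (d : tree) : tree :=
  foldl (fun a x => tparse_step x a) Nil (rev (tlist d)).

Lemma tparse_word x : tparse (tword x) = trows (parse x).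
Proof.
rewrite /tparse /tword tree_of_seqK foldl_rev.
elim: x => //= a x ->; rewrite /tparse_step; case: a => [[]|] //=;
by case: (parse x).
Qed.

Lemma ptime_parse F : ptime F -> ptime (fun d => tparse (F d)).
Proof.
move=> pF; apply: ptime_ext (ptime_fold
  (G := fun x a _ => tparse_step x a) (ptime_rev pF) ptime_nil _ _) => [d||].
- by rewrite tree_of_seqK.
- have pa : ptime (fun d => thead (ttail d)) := ptime_thead (ptime_ttail ptime_id).
  have px : ptime thead := ptime_thead ptime_id.
  have pc := ptime_cons (ptime_cons px (ptime_thead pa)) (ptime_ttail pa).
  exact: ptime_if_nonnil (ptime_ttail px) (ptime_cons ptime_nil pa)
    (ptime_if_nonnil pa pc ptime_nil).
- exists (fun n => n + 2) => [|x a d]; first by pol_tac.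
  by rewrite /tparse_step; case: (nonnil _) => //=; [|case: a => //= *]; lia.
Qed.

Definition twf (d : tree) : bool :=
  nonnil d ==> nonnil (ttail (thead (tree_of_seq (rev (tlist d))))).

Lemma twf_word x : twf (tword x) = is_sep (last Sep x).
Proof.
rewrite /twf /tword tree_of_seqK; case/lastP: x => [|x a] //.
rewrite last_rcons map_rcons rev_rcons /=.
have -> : nonnil (tree_of_seq (rcons (map tree_of_letter x) (tree_of_letter a))).
  by case: x.
by case: a => [[]|].
Qed.

Definition tsep : tree := tree_of_letter Sep.

Definition tenc (d : tree) : tree :=
  foldl (fun a r => tree_of_seq (tlist r ++ tsep :: tlist a)) Nil (rev (tlist d)).

Lemma tenc_rows R : tenc (trows R) = tword (enc_rows R).
Proof.
rewrite /tenc /trows /tword tree_of_seqK foldl_rev.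
elim: R => //= r R ->; rewrite /enc_rows /= map_cat map_rcons cat_rcons !tree_of_seqK.
by rewrite -map_comp; congr (tree_of_seq (_ ++ _)); apply: eq_map; case.
Qed.

Lemma ptime_enc F : ptime F -> ptime (fun d => tenc (F d)).
Proof.
move=> pF; apply: ptime_ext (ptime_fold
  (G := fun r a _ => tree_of_seq (tlist r ++ tlist (Cons tsep a)))
  (ptime_rev pF) ptime_nil _ _) => [d||].
- by rewrite tree_of_seqK.
- apply: ptime_cat (ptime_thead ptime_id) (ptime_cons (ptime_const _) _).
  exact: ptime_thead (ptime_ttail ptime_id).
- exists (fun n => n + 6) => [|x a d]; first by pol_tac.
  rewrite tsize_tree_of_seq map_cat sumn_cat size_cat /=.
  have := tsize_tree_of_seq (tlist x); have := tsize_tree_of_seq (tlist a).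
  rewrite !tlistK; lia.
Qed.

(** * Computing matrices entry by entry *)

Definition mkmat (r c : nat) (e : nat -> nat -> bool) : seq (seq bool) :=
  [seq [seq e i j | j <- iota 0 c] | i <- iota 0 r].

Lemma ptime_mkmat (r c : tree -> nat) (e : tree -> nat -> nat -> bool) :
  nptime r -> nptime c ->
  bptime (fun x => e (ttail (ttail x)) (tsz (thead (ttail x))) (tsz (thead x))) ->
  ptime (fun d => trows (mkmat (r d) (c d) (e d))).
Proof.
move=> pr pc pe.
have := ptime_map_iota (F := fun i d => tree_of_seq [seq tbool (e d i j)
  | j <- iota 0 (c d)]) pr _.
move=> h; apply: ptime_ext (h _) => {h} [d|].
  rewrite /trows /mkmat -map_comp; congr tree_of_seq; apply: eq_map => i /=.
  by rewrite -map_comp.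
apply: (ptime_map_iota (n := fun d => c (ttail d))
  (F := fun j d => tbool (e (ttail d) (tsz (thead d)) j))).
- exact: ptime_comp pc (ptime_ttail ptime_id).
- exact: pe.
Qed.

Definition bit R (i j : nat) : bool := nth false (nth [::] R i) j.
Definition rowsize R (i : nat) : nat := size (nth [::] R i).

Lemma nth_rows_of d i :
  nth [::] (rows_of d) i = [seq nonnil t | t <- tlist (nth Nil (tlist d) i)].
Proof.
rewrite /rows_of; elim: (tlist d) i => [|r l IH] [|i] //=; exact: IH.
Qed.

Lemma bptime_bit M i j : ptime M -> nptime i -> nptime j ->
  bptime (fun d => bit (rows_of (M d)) (i d) (j d)).
Proof.
move=> pM pi pj.
apply: ptime_ext (bptime_nonnil (ptime_nth (ptime_nth pM pi) pj)) => d.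
congr tbool; rewrite /bit nth_rows_of.
by elim: (tlist _) (j d) => [|r l IH] [|m] //=; apply: IH.
Qed.

Lemma nptime_rowsize M i : ptime M -> nptime i ->
  nptime (fun d => rowsize (rows_of (M d)) (i d)).
Proof.
move=> pM pi; apply: ptime_ext (nptime_tsz (ptime_nth pM pi)) => d.
by rewrite /rowsize nth_rows_of size_map.
Qed.

Lemma nptime_size_rows M : ptime M -> nptime (fun d => size (rows_of (M d))).
Proof.
move=> pM; apply: ptime_ext (nptime_tsz pM) => d; by rewrite size_map.
Qed.

(** The common shape of all reductions: parse, test validity, write the new matrix entry by entry
    and add [a] to the parameter. Invalid inputs, which are no-instances of [L1], are sent to a
    fixed word that is a no-instance of [L2]. *)
Lemma matrix_reduction (L1 L2 : pproblem) (V : seq (seq bool) -> bool)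
    (r c : seq (seq bool) -> nat) (e : seq (seq bool) -> nat -> nat -> bool) a :
  bptime (fun d => V (rows_of d)) ->
  nptime (fun d => r (rows_of d)) -> nptime (fun d => c (rows_of d)) ->
  bptime (fun x => e (rows_of (ttail (ttail x))) (tsz (thead (ttail x)))
                     (tsz (thead x))) ->
  (forall x k, L1 x k -> exists2 R, x = enc_rows R & V R) ->
  (forall k, ~ L2 [:: Bit true] k) ->
  (forall R k, V R ->
     L1 (enc_rows R) k <-> L2 (enc_rows (mkmat (r R) (c R) (e R))) (a + k)) ->
  poly_reducible L1 L2.
Proof.
move=> pV pr pc pe hL1 hL2 hL.
pose M d := tparse (thead d).
pose F d := if twf (thead d) && V (rows_of (M d))
  then Cons (tenc (trows (mkmat (r (rows_of (M d))) (c (rows_of (M d)))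
                                (e (rows_of (M d))))))
            (tree_of_nat (a + tsz (ttail d)))
  else Cons (tword [:: Bit true]) (ttail d).
have pM : ptime M := ptime_parse (ptime_thead ptime_id).
have pn : ptime thead := ptime_thead ptime_id.
exists F, (fun k => a + k); split; last 1 first.
- move=> x k.
  have -> : F (tree_of_instance x k) = if is_sep (last Sep x) && V (parse x)
     then tree_of_instance (enc_rows (mkmat (r (parse x)) (c (parse x)) (e (parse x))))
            (a + k)
     else tree_of_instance [:: Bit true] k.
    rewrite /F /M /= -/(tword x) twf_word tparse_word trowsK tenc_rows tsz_nat.
    by [].
  case: ifP => [/andP[wf Vx]|nV].
  + exists (enc_rows (mkmat (r (parse x)) (c (parse x)) (e (parse x)))), (a + k).
    by split=> //; rewrite -hL // parseK.
  + exists [:: Bit true], k; split=> //; first exact: leq_addl.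
    split=> [/hL1[R eR VR]|/hL2//].
    by move: nV; rewrite eR wf_enc_rows enc_rowsK VR.
- apply: ptime_if.
  + apply: bptime_and (ptime_comp pV pM).
    apply: bptime_imply (bptime_nonnil pn) (bptime_nonnil _).
    exact: ptime_ttail (ptime_thead (ptime_rev pn)).
  + apply: ptime_cons; last first.
      exact: nptime_add (nptime_const a) (nptime_tsz (ptime_ttail ptime_id)).
    apply: (ptime_enc (F := fun d => trows (mkmat (r (rows_of (M d)))
      (c (rows_of (M d))) (e (rows_of (M d)))))).
    exact: (ptime_comp (F := M) (ptime_mkmat (e := fun d => e (rows_of d)) pr pc pe)).
  + exact: ptime_cons (ptime_const _) (ptime_ttail ptime_id).
- by apply: pol_add; [exact: pol_const | exact: pol_id].
Qed.

(** * Footprinting sequences as lists of (vertex, footprint) pairs *)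

Definition fpseq (T U : Type) (P Q : T -> U -> bool) (w : seq (T * U)) : bool :=
  all (fun p => P p.1 p.2) w && pairwise (fun p q => ~~ Q p.1 q.2) w.

Lemma fpseq_take (T U : Type) (P Q : T -> U -> bool) n w :
  fpseq P Q w -> fpseq P Q (take n w).
Proof.
rewrite -{1}(cat_take_drop n w) /fpseq all_cat pairwise_cat.
by case/andP=> /andP[-> _] /and3P[_ -> _].
Qed.

(** A vertex covers its own footprint, so an earlier occurrence of it would have covered the
    footprint of a later one. *)
Lemma fpseq_uniq (T : eqType) (U : Type) (P : T -> U -> bool) w :
  fpseq P P w -> uniq (unzip1 w).
Proof.
case/andP=> aw pw; rewrite uniq_pairwise pairwise_map.
apply: (sub_in_pairwise _ aw pw) => p q _ Pq; apply: contra => /eqP ->.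
exact: Pq.
Qed.

Lemma pairwise_enum_ord k : pairwise (fun i j : 'I_k => i < j) (enum 'I_k).
Proof.
rewrite -(pairwise_map (fun i : 'I_k => val i) ltn) val_enum_ord.
by rewrite -(sorted_pairwise ltn_trans) iota_ltn_sorted.
Qed.

(** Choosing one footprint per position turns the nonempty set differences into conditions on pairs,
    which survive filtering, mapping and reversal of lists. *)
Lemma footprintingP (T U : finType) (P Q : T -> {set U}) k (s : k.-tuple T) :
  footprinting P Q s <->
  exists2 w : seq (T * U), unzip1 w = s &
    fpseq (fun v u => u \in P v) (fun v u => u \in Q v) w.
Proof.
split=> [fs|[w ws /andP[aw pw]] i].
  have /fin_all_exists[f hf] : forall i : 'I_k, exists u,
      u \in P (tnth s i) /\ forall j : 'I_k, j < i -> u \notin Q (tnth s j).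
    move=> i; have /set0Pn[u] := fs i; rewrite inE => /andP[uQ uP].
    exists u; split=> // j ltji; apply: contra uQ => uj.
    by apply/bigcupP; exists j.
  exists [seq (tnth s i, f i) | i <- enum 'I_k].
    by rewrite /unzip1 -map_comp -[RHS]map_tnth_enum.
  rewrite /fpseq all_map pairwise_map; apply/andP; split.
    by apply/allP => i _ /=; case: (hf i).
  apply: sub_pairwise (pairwise_enum_ord k) => i j /= ltij.
  by have [_] := hf j; apply.
have szw : size w = k by rewrite -(size_map fst) -/(unzip1 w) ws size_tuple.
case: w ws aw pw szw => [|x0 w0] ws aw pw szw.
  by have := ltn_ord i; rewrite -{2}szw.
set w := x0 :: w0 in ws aw pw szw.
have st (j : 'I_k) : tnth s j = (nth x0 w j).1.
  by rewrite (tnth_nth x0.1) -ws (nth_map x0) // szw.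
apply/set0Pn; exists (nth x0 w i).2; rewrite inE st.
rewrite (all_nthP x0 aw) ?szw // andbT; apply/bigcupP => -[j ltji].
rewrite st; apply/negP.
by apply: (pairwiseP x0 pw) => //; rewrite inE szw.
Qed.

(* [P] is the footprinting relation and [Q] the dominating one. *)
Definition fpn (r c : nat) (P Q : nat -> nat -> bool) (k : nat) : Prop :=
  exists w : seq (nat * nat), [/\ size w = k,
    all (fun p => (p.1 < r) && (p.2 < c)) w, uniq (unzip1 w) & fpseq P Q w].

Definition covn r c E := fpn r c E E.

(** Prefixes inherit the property; hence asking for length at least [k] and for length exactly [k]
    amounts to the same. *)
Lemma fpn_leq r c P Q k l : k <= l -> fpn r c P Q l -> fpn r c P Q k.
Proof.
move=> lekl [w [sw aw uw fw]]; exists (take k w); split.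
- by rewrite size_takel // sw.
- by move: aw; rewrite -{1}(cat_take_drop k w) all_cat; case/andP.
- by rewrite /unzip1 map_take take_uniq.
- exact: fpseq_take.
Qed.

Lemma covn_intro r c E (w : seq (nat * nat)) :
  all (fun p => (p.1 < r) && (p.2 < c)) w -> fpseq E E w ->
  covn r c E (size w).
Proof. by move=> aw fw; exists w; split=> //; apply: fpseq_uniq fw. Qed.

Lemma lift_ranged n m (w : seq (nat * nat)) :
  all (fun p => (p.1 < n) && (p.2 < m)) w ->
  exists w' : seq ('I_n * 'I_m), w = [seq (val p.1, val p.2) | p <- w'].
Proof.
elim: w => [|[v u] w IH] /=; first by exists [::].
case/andP=> /andP[hv hu] /IH[w' ->].
by exists ((Ordinal hv, Ordinal hu) :: w').
Qed.

(** Passage from ordinals to numbers. The predicate [A] serves the one-sided problem: restricting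
    the vertices is absorbed into the footprinting relation. *)
Lemma footprinting_fpn n m (P Q : 'I_n -> {set 'I_m}) (p q : nat -> nat -> bool)
    (A : pred 'I_n) (a : pred nat) k :
  (forall v u, (u \in P v) = p v u) -> (forall v u, (u \in Q v) = q v u) ->
  (forall v, A v = a v) ->
  (exists s : k.-tuple 'I_n, [/\ all A s, uniq s & footprinting P Q s]) <->
  fpn n m (fun i j => a i && p i j) q k.
Proof.
move=> hp hq ha; split=> [[s [As us /footprintingP[w ws /andP[aw pw]]]]|].
  exists [seq (val p.1, val p.2) | p <- w]; split.
  - by rewrite size_map -(size_map fst w) -/(unzip1 w) ws size_tuple.
  - by rewrite all_map; apply/allP => x _ /=; rewrite !ltn_ord.
  - rewrite /unzip1 -map_comp (map_comp val fst) map_inj_uniq; last exact: val_inj.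
    by rewrite -/(unzip1 w) ws.
  - rewrite /fpseq all_map pairwise_map; apply/andP; split.
      apply/allP => x xw /=; rewrite -hp (allP aw) // andbT -ha.
      by apply: (allP As); rewrite -ws map_f.
    by apply: sub_pairwise pw => x y /=; rewrite -hq.
case=> w [sw /lift_ranged[w' ew]]; subst w.
rewrite /fpseq all_map pairwise_map => uw /andP[aw pw].
have sw' : size (unzip1 w') == k by rewrite size_map -sw size_map.
exists (Tuple sw'); split=> /=.
- rewrite all_map; apply: sub_all aw => x /= /andP[]; by rewrite ha.
- move: uw; rewrite /unzip1 -map_comp (map_comp val fst) map_inj_uniq //.
  exact: val_inj.
- apply/footprintingP; exists w' => //; apply/andP; split.
    by apply: sub_all aw => x /= /andP[_]; rewrite hp.
  by apply: sub_pairwise pw => x y /=; rewrite hq.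
Qed.

(** * The five problems on matrices *)

Definition all_below (n : nat) (P : pred nat) : bool := all P (iota 0 n).

Lemma all_belowP n (P : pred nat) :
  reflect (forall i, i < n -> P i) (all_below n P).
Proof.
apply: (iffP allP) => h i; last by rewrite mem_iota => /h.
by move=> lti; apply: h; rewrite mem_iota.
Qed.

Definition valid_graph R : bool :=
  all_below (size R) (fun i => [&& rowsize R i == size R, ~~ bit R i i &
    all_below (size R) (fun j => bit R i j == bit R j i)]).

(** Row 0 is the indicator of the side [A]; the adjacency matrix starts at row 1. *)
Definition valid_bigraph R : bool :=
  [&& 0 < size R, valid_graph (behead R), rowsize R 0 == size (behead R) &
    all_below (size (behead R)) (fun i => all_below (size (behead R)) (fun j =>
      bit (behead R) i j ==> (bit R 0 i != bit R 0 j)))].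

Definition valid_hypergraph R : bool :=
  [&& 0 < size R, all_below (rowsize R 0) (fun j => bit R 0 j) &
    all_below (size R) (fun i => rowsize R i == rowsize R 0)].

(** * Graphs over ordinals and their matrices *)

Definition ord_row n (A : pred 'I_n) : seq bool := [seq A u | u <- enum 'I_n].

Lemma size_ord_row n (A : pred 'I_n) : size (ord_row A) = n.
Proof. by rewrite size_map size_enum_ord. Qed.

Lemma nth_ord_row n (A : pred 'I_n) (u : 'I_n) : nth false (ord_row A) u = A u.
Proof. by rewrite (nth_map u) ?size_enum_ord // nth_ord_enum. Qed.

Lemma ord_row_nth n (r : seq bool) :
  size r = n -> ord_row (fun u : 'I_n => nth false r u) = r.
Proof.
move=> sr; rewrite /ord_row (map_comp (nth false r) val) val_enum_ord -sr.
exact: mkseq_nth.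
Qed.

Lemma enc_rows_cons r R : enc_rows (r :: R) = rcons (map Bit r) Sep ++ enc_rows R.
Proof. by []. Qed.

Lemma enc_row_ord n (A : pred 'I_n) : enc_row A = rcons (map Bit (ord_row A)) Sep.
Proof. by rewrite /enc_row /ord_row -map_comp. Qed.

Lemma enc_rows_ord (I : Type) n (A : I -> pred 'I_n) (l : seq I) :
  flatten [seq enc_row (A x) | x <- l] = enc_rows [seq ord_row (A x) | x <- l].
Proof. by elim: l => //= x l ->; rewrite enc_row_ord -enc_rows_cons. Qed.

Definition graph_rows n (G : sgraph 'I_n) : seq (seq bool) :=
  [seq ord_row (G u) | u <- enum 'I_n].

Lemma enc_graph_rows n (G : sgraph 'I_n) : enc_graph G = enc_rows (graph_rows G).
Proof. exact: enc_rows_ord. Qed.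

Lemma size_graph_rows n (G : sgraph 'I_n) : size (graph_rows G) = n.
Proof. by rewrite size_map size_enum_ord. Qed.

Lemma nth_graph_rows n (G : sgraph 'I_n) (u : 'I_n) :
  nth [::] (graph_rows G) u = ord_row (G u).
Proof. by rewrite (nth_map u) ?size_enum_ord // nth_ord_enum. Qed.

Lemma bit_graph_rows n (G : sgraph 'I_n) (u v : 'I_n) :
  bit (graph_rows G) u v = G u v.
Proof. by rewrite /bit nth_graph_rows nth_ord_row. Qed.

Lemma valid_graph_rows n (G : sgraph 'I_n) : valid_graph (graph_rows G).
Proof.
apply/all_belowP => i; rewrite size_graph_rows => lti.
pose u := Ordinal lti; apply/and3P; split.
- by rewrite -[i]/(val u) /rowsize nth_graph_rows size_ord_row.
- by rewrite -[i]/(val u) bit_graph_rows adj_irr.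
- apply/all_belowP => j ltj; pose v := Ordinal ltj.
  by rewrite -[i]/(val u) -[j]/(val v) !bit_graph_rows adj_sym.
Qed.

Lemma graph_of_rows R : valid_graph R -> exists2 G : sgraph 'I_(size R),
  graph_rows G = R & forall u v, G u v = bit R u v.
Proof.
move/all_belowP=> h.
have sym : symmetric (fun u v : 'I_(size R) => bit R u v).
  by move=> u v; have /and3P[_ _ /all_belowP/(_ v (ltn_ord v))/eqP] := h u (ltn_ord u).
have irr : irreflexive (fun u v : 'I_(size R) => bit R u v).
  by move=> u; have /and3P[_ /negbTE] := h u (ltn_ord u).
exists (SGraph sym irr) => //; apply: (@eq_from_nth _ [::]).
  by rewrite size_graph_rows.
move=> i; rewrite size_graph_rows => lti; pose u := Ordinal lti.
rewrite -[i]/(val u) nth_graph_rows /= ord_row_nth //.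
by have /and3P[/eqP] := h i lti.
Qed.

Lemma enc_rows_inj : injective enc_rows. Proof. exact: can_inj enc_rowsK. Qed.

(** By injectivity of [enc_rows] any graph encoded by [R] has [R] as its matrix, and a valid [R] is
    the matrix of some graph; so the quantifier over graphs disappears. *)
Lemma graph_problem (Phi : forall n, sgraph 'I_n -> Prop)
    (Psi : nat -> (nat -> nat -> bool) -> Prop) R :
  (forall n (G : sgraph 'I_n) (b : nat -> nat -> bool),
     (forall u v : 'I_n, G u v = b u v) ->
     Phi n G <-> Psi n b) ->
  valid_graph R ->
  (exists n (G : sgraph 'I_n), enc_rows R = enc_graph G /\ Phi n G) <->
  Psi (size R) (bit R).
Proof.
move=> h vR; split=> [[n [G [+ hG]]]|hR].
  rewrite enc_graph_rows => /enc_rows_inj ->; rewrite size_graph_rows.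
  by rewrite -h; [exact: hG | move=> u v; rewrite bit_graph_rows].
have [G eG bG] := graph_of_rows vR; exists (size R), G.
by rewrite enc_graph_rows eG; split=> //; rewrite h; first exact: hR.
Qed.

Lemma graph_problem_valid (Phi : forall n, sgraph 'I_n -> Prop) x :
  (exists n (G : sgraph 'I_n), x = enc_graph G /\ Phi n G) ->
  exists2 R, x = enc_rows R & valid_graph R.
Proof.
case=> n [G [-> _]]; exists (graph_rows G); first exact: enc_graph_rows.
exact: valid_graph_rows.
Qed.

(** * The problems as statements about footprinting on numbers *)

Definition closure (b : nat -> nat -> bool) i j := (i == j) || b i j.

Lemma footprinting_geq n m (P Q : 'I_n -> {set 'I_m}) (p q : nat -> nat -> bool) k :
  (forall v u, (u \in P v) = p v u) -> (forall v u, (u \in Q v) = q v u) ->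
  (exists l (s : l.-tuple 'I_n), k <= l /\ (uniq s /\ footprinting P Q s)) <->
  fpn n m p q k.
Proof.
move=> hp hq; have h l := footprinting_fpn (A := xpredT) (a := xpredT) l hp hq
  (fun=> erefl).
split=> [[l [s [lkl [us fs]]]]|].
  by apply: fpn_leq lkl _; apply/h; exists s; split=> //; apply/allP.
by move/h=> [s [_ us fs]]; exists k, s.
Qed.

Lemma grundy_dominationE R k : valid_graph R ->
  grundy_domination (enc_rows R) k <->
  covn (size R) (size R) (closure (bit R)) k.
Proof.
apply: (graph_problem (Psi := fun n b => covn n n (closure b) k)) => n G b hb.
by apply: footprinting_geq => v u; rewrite !inE hb eq_sym.
Qed.

Lemma total_grundy_dominationE R k : valid_graph R ->
  total_grundy_domination (enc_rows R) k <->
  covn (size R) (size R) (bit R) k.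
Proof.
apply: (graph_problem (Psi := fun n b => covn n n b k)) => n G b hb.
by apply: footprinting_geq => v u; rewrite !inE hb.
Qed.

Lemma L_grundy_dominationE R k : valid_graph R ->
  L_grundy_domination (enc_rows R) k <->
  fpn (size R) (size R) (closure (bit R)) (bit R) k.
Proof.
apply: (graph_problem (Psi := fun n b => fpn n n (closure b) b k)) => n G b hb.
by apply: footprinting_geq => v u; rewrite !inE hb // eq_sym.
Qed.

(** Every vertex listed satisfies [a], so the dominating relation may be restricted by [a] as
    well. *)
Lemma fpn_covn r c a b k :
  fpn r c (fun i j => a i && b i j) b k <-> covn r c (fun i j => a i && b i j) k.
Proof.
split=> -[w [sw rw uw /andP[aw pw]]]; exists w; split=> //; rewrite /fpseq aw /=.
  by apply: sub_pairwise pw => p q; apply: contra => /andP[].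
by apply: (sub_in_pairwise _ aw pw) => p q /= /andP[-> _].
Qed.

Lemma one_sidedE R k : valid_bigraph R ->
  one_sided_grundy_total_domination (enc_rows R) k <->
  covn (size R).-1 (size R).-1 (fun i j => bit R 0 i && bit R i.+1 j) k.
Proof.
case: R => [|a R] // /and4P[_ /= vR /eqP sa /all_belowP bip].
rewrite -fpn_covn; split.
  case=> n [G [A [bA [eA [s [sA [us fs]]]]]]].
  move: eA; rewrite /enc_bigraph enc_row_ord enc_graph_rows -enc_rows_cons.
  case/enc_rows_inj => ea eR; rewrite ea eR size_graph_rows.
  have := footprinting_fpn (P := open_nbh G) (Q := open_nbh G)
    (p := bit (graph_rows G)) (q := bit (graph_rows G))
    (A := fun u => u \in A) (a := nth false (ord_row (fun u => u \in A))) k.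
  case.
  - by move=> v u; rewrite inE bit_graph_rows.
  - by move=> v u; rewrite inE bit_graph_rows.
  - by move=> v; rewrite nth_ord_row.
  move=> h _; apply: h; exists s; split=> //.
  by apply/all_tnthP.
have [G eG bG] := graph_of_rows vR.
have := footprinting_fpn (P := open_nbh G) (Q := open_nbh G)
  (p := bit R) (q := bit R) (A := fun u => nth false a u) (a := nth false a) k.
case=> [v u|v u|//|_ h /h [s [As us fs]]]; rewrite ?inE ?bG //.
exists (size R), G, [set u : 'I_(size R) | nth false a u].
split; last split; last exists s.
- move=> u v; rewrite bG !inE => buv.
  by have /all_belowP/(_ v (ltn_ord v)) := bip u (ltn_ord u); rewrite buv.
- rewrite /enc_bigraph enc_row_ord enc_graph_rows eG -enc_rows_cons.
  congr (enc_rows (_ :: _)); rewrite -[LHS](ord_row_nth sa).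
  by apply: eq_map => u; rewrite inE.
- by split=> // i; rewrite inE; apply: (all_tnthP As).
Qed.

Lemma one_sided_valid x k : one_sided_grundy_total_domination x k ->
  exists2 R, x = enc_rows R & valid_bigraph R.
Proof.
case=> n [G [A [bA [-> _]]]].
exists (ord_row (fun u => u \in A) :: graph_rows G).
  by rewrite /enc_bigraph enc_row_ord enc_graph_rows.
rewrite /valid_bigraph /= valid_graph_rows /rowsize /= size_ord_row.
rewrite size_graph_rows eqxx /=; apply/all_belowP => i lti.
apply/all_belowP => j ltj; pose u := Ordinal lti; pose v := Ordinal ltj.
rewrite -[i]/(val u) -[j]/(val v) bit_graph_rows.
by apply/implyP => /bA; rewrite /bit [nth [::] _ 0]/= !nth_ord_row.
Qed.

(** Since a listing may repeat an edge, a set is represented by the index of its first occurrence,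
    and an index by the set found there. *)
Lemma grundy_coveringE R k : valid_hypergraph R ->
  grundy_covering_in_hypergraphs (enc_rows R) k <->
  covn (size R).-1 (rowsize R 0) (fun i j => bit R i.+1 j) k.
Proof.
case: R => [|r0 R] // /and3P[_ /all_belowP h0 /all_belowP hs].
rewrite /= in hs; rewrite [(size _).-1]/= [rowsize _ 0]/=.
(* Stated for any listing, as it is applied both to a given one and to the one read off the rows. *)
have key n (es : seq {set 'I_n}) (b : nat -> nat -> bool) :
   (forall i (u : 'I_n), i < size es -> (u \in nth set0 es i) = b i u) ->
   (exists l (s : l.-tuple {set 'I_n}), k <= l /\ covering_seq [set:: es] s) <->
   covn (size es) n b k.
  move=> hb; split.
    case=> l [s [lkl [sE /footprintingP[w ws /andP[aw pw]]]]].
    apply: fpn_leq lkl _.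
    have -> : l = size [seq (index p.1 es, val p.2) | p <- w].
      by rewrite size_map -(size_map fst w) -/(unzip1 w) ws size_tuple.
    have inE' p : p \in w -> p.1 \in es.
      move/(map_f fst); rewrite -/(unzip1 w) ws => /tnthP[i ->].
      by have := sE i; rewrite inE.
    have E p q : p \in w -> b (index p.1 es) (val q.2) = (q.2 \in p.1).
      by move/inE' => pe; rewrite -hb ?index_mem // nth_index.
    apply: covn_intro.
      rewrite all_map; apply/allP => p /inE' pe /=.
      by rewrite index_mem pe ltn_ord.
    rewrite /fpseq all_map pairwise_map; apply/andP; split.
      by apply/allP => p pw' /=; rewrite E // (allP aw).
    apply: (sub_in_pairwise (P := mem w)) pw; last by apply/allP.
    by move=> p q pw' _ /=; rewrite E.
  case=> w [sw rw _ fw]; case: (lift_ranged rw) => w' ew; subst w.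
  move: fw; rewrite /fpseq all_map pairwise_map => /andP[aw pw].
  pose w2 := [seq (nth set0 es (val p.1), p.2) | p <- w'].
  have sw2 : size (unzip1 w2) == k by rewrite !size_map -sw size_map.
  exists k, (Tuple sw2); split=> //; split.
    move=> i; rewrite inE; have : tnth (Tuple sw2) i \in unzip1 w2 by exact: mem_tnth.
    by case/mapP=> p /mapP[q _ ->] ->; rewrite /= mem_nth.
  apply/footprintingP; exists w2 => //; rewrite /fpseq all_map pairwise_map.
  apply/andP; split.
    by apply: sub_all aw => p /=; rewrite hb.
  by apply: sub_pairwise pw => p q /=; rewrite hb.
split.
  case=> n [_ [[es [-> ex]] cs]].
  move: ex; rewrite /enc_hypergraph enc_row_ord.
  rewrite (enc_rows_ord (fun C : {set 'I_n} => fun u => u \in C)) -enc_rows_cons.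
  case/enc_rows_inj => -> ->; rewrite /rowsize /= size_ord_row size_map.
  apply/(key _ es) => // i u lti; rewrite /bit /= (nth_map set0) //.
  by rewrite nth_ord_row.
pose n := rowsize (r0 :: R) 0.
pose es := [seq [set u : 'I_n | nth false r u] | r <- R].
have se : size es = size R by rewrite size_map.
rewrite -[X in covn X]se => hc; exists n, [set:: es]; split.
  exists es; split=> //.
  rewrite /enc_hypergraph enc_row_ord.
  rewrite (enc_rows_ord (fun C : {set 'I_n} => fun u => u \in C)) -enc_rows_cons.
  congr (enc_rows (_ :: _)).
    rewrite -[LHS](ord_row_nth (erefl : size r0 = n)).
    by apply: eq_map => u; apply: h0.
  rewrite -[LHS]map_id -map_comp; apply/eq_in_map => r /(nthP [::])[i lti ei] /=.
  rewrite -[LHS](@ord_row_nth n) /=; last by rewrite -ei; apply/eqP/(hs i.+1).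
  by apply: eq_map => u; rewrite inE.
apply: (proj2 (key _ es _ _)) hc => i u; rewrite se => lti.
by rewrite (nth_map [::]) // inE.
Qed.

Lemma grundy_covering_valid x k : grundy_covering_in_hypergraphs x k ->
  exists2 R, x = enc_rows R & valid_hypergraph R.
Proof.
case=> n [E [[es [_ ->]] _]].
exists (ord_row (fun _ : 'I_n => true) ::
  [seq ord_row (fun u => u \in C) | C : {set 'I_n} <- es]).
  rewrite /enc_hypergraph enc_row_ord.
  by rewrite (enc_rows_ord (fun C : {set 'I_n} => fun u => u \in C)).
apply/and3P; split=> //; rewrite /rowsize /= size_ord_row; apply/all_belowP.
  by move=> i lti; rewrite /bit /= -[i]/(val (Ordinal lti)) nth_ord_row.
case=> [|i] /=; rewrite ?size_ord_row // size_map => lti.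
by rewrite (nth_map set0) // size_ord_row.
Qed.

(** * The combinatorial equivalences *)

Lemma fpn_sub_in r c (P P' Q Q' : nat -> nat -> bool) k :
  (forall i j, i < r -> j < c -> P i j -> P' i j) ->
  (forall i j, i < r -> j < c -> Q' i j -> Q i j) ->
  fpn r c P Q k -> fpn r c P' Q' k.
Proof.
move=> hP hQ [w [sw rw uw /andP[aw pw]]]; exists w; split=> //.
apply/andP; split.
  apply/allP => p pw'; have /andP[h1 h2] := allP rw p pw'.
  exact: hP (allP aw p pw').
apply: (sub_in_pairwise _ rw pw) => p q /andP[h1 _] /andP[_ h2].
by apply: contra; apply: hQ.
Qed.

Lemma covn_eq_in r c E E' k :
  (forall i j, i < r -> j < c -> E i j = E' i j) ->
  covn r c E k <-> covn r c E' k.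
Proof. by move=> h; split; apply: fpn_sub_in => i j hi hj; rewrite h. Qed.

Lemma pairwise_rev (T : Type) (e : rel T) s :
  pairwise e (rev s) = pairwise (fun x y => e y x) s.
Proof. by elim: s => //= x s IH; rewrite rev_cons pairwise_rcons all_rev IH. Qed.

(* The L-sequences of a graph are the covering sequences of the hypergraph on
   two copies of the vertex set with edges N[v] + N(v): a vertex footprinting
   itself uses the first copy, all other footprints live in the second. *)
Definition L_incidence n (b : nat -> nat -> bool) i j : bool :=
  if j < n then closure b i j else b i (j - n).

Lemma L_fpn_covn n b k : (forall i, ~~ b i i) ->
  fpn n n (closure b) b k <-> covn n (n + n) (L_incidence n b) k.
Proof.
move=> irr; split=> -[w [sw rw uw /andP[aw pw]]].
  pose f p := if p.1 == p.2 then p else (p.1, n + p.2) : nat * nat.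
  rewrite -sw -(size_map f); apply: covn_intro.
    rewrite all_map; apply: sub_all rw => -[i j]; rewrite /f /=.
    by case: eqP => _ /=; lia.
  have f1 p : (f p).1 = p.1 by rewrite /f; case: eqP.
  rewrite /fpseq all_map pairwise_map; apply/andP; split.
    apply/allP => -[i j] pw'; have := allP rw _ pw'; have := allP aw _ pw'.
    rewrite /f /L_incidence /closure /=; case: eqP => /= [->|_] h1 h2.
      by case/andP: h2 => _ ->; rewrite eqxx.
    by rewrite ltnNge leq_addr /= addKn.
  (* A self-footprint lies in the first copy, where closed neighbourhoods count: it is avoided by
     earlier vertices only because they are also distinct from it. *)
  have {uw}pw : pairwise
      (fun p q => (p.1 != q.1) && ~~ b p.1 q.2) w.
    have := pairwise_relI (fun p q => p.1 != q.1) (fun p q => ~~ b p.1 q.2) w.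
    by move=> ->; rewrite pw andbT; move: uw; rewrite uniq_pairwise pairwise_map.
  apply: (sub_in_pairwise _ rw pw) => p q _ /andP[_ q2] /andP[npq nb].
  rewrite /= /L_incidence f1 /f /closure; case: eqP => [e|_].
    by rewrite q2 -e (negbTE npq) e.
  by rewrite ltnNge leq_addr /= addKn.
(* Conversely the copy is forgotten: as N(v) is contained in N[v], a footprint from either copy lies
   in the closed neighbourhood and avoids the earlier open ones. *)
exists [seq (p.1, if p.2 < n then p.2 else p.2 - n) | p <- w]; split.
- by rewrite size_map.
- by rewrite all_map; apply: sub_all rw => -[i j] /=; case: ifP; lia.
- by rewrite /unzip1 -map_comp.
- rewrite /fpseq all_map pairwise_map; apply/andP; split.
    apply: sub_all aw => -[i j] /=; rewrite /L_incidence /closure.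
    by case: ifP => // _ ->; rewrite orbT.
  apply: sub_pairwise pw => p q /=; rewrite /L_incidence.
  by case: ifP => // _; apply: contra => h; rewrite /closure h orbT.
Qed.

(** * Graphs built from a hypergraph with [m] edges and [n] points *)

Section CoBipartite.

Variables (m n : nat) (inc : nat -> nat -> bool).
Hypothesis inc_range : forall i j, inc i j -> (i < m) && (j < n).

(* Two cliques joined by the incidence relation; vertices [m], [m + 1] and the
   last two vertices are dummies without neighbours in the other clique. *)
Definition cobip a b : bool :=
  if a == b then false else
  if (a < m.+2) == (b < m.+2) then true else
  if a < m.+2 then inc a (b - m.+2) else inc b (a - m.+2).

Lemma cobip_sym a b : cobip a b = cobip b a.
Proof.
rewrite /cobip [b == a]eq_sym; case: eqP => // _.
by rewrite [(b < _) == _]eq_sym; case: (a < _); case: (b < _).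
Qed.

Lemma cobip_irr a : cobip a a = false.
Proof. by rewrite /cobip eqxx. Qed.

Lemma cobip_same a b : (a < m.+2) = (b < m.+2) -> cobip a b = (a != b).
Proof. by rewrite /cobip => ->; rewrite eqxx; case: eqP. Qed.

Lemma cobip_lr a b : a < m.+2 -> m.+2 <= b -> cobip a b = inc a (b - m.+2).
Proof. by rewrite /cobip => ha hb; case: eqP => [|_]; [lia | rewrite ha ltnNge hb]. Qed.

Lemma cobip_rl a b : m.+2 <= a -> b < m.+2 -> cobip a b = inc b (a - m.+2).
Proof. by move=> ha hb; rewrite cobip_sym cobip_lr. Qed.

Lemma closure_cobip_cross a b :
  (a < m.+2) != (b < m.+2) -> closure cobip a b = cobip a b.
Proof. by rewrite /closure; case: (eqVneq a b) => [->|//]; rewrite eqxx. Qed.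

Lemma incF i j : (m <= i) || (n <= j) -> inc i j = false.
Proof. by move=> h; apply/negbTE/negP => /inc_range; lia. Qed.

Let N := m.+2 + n.+2.

(** The edges are chosen with their footprints among the points, between an edge-side and a
    point-side dummy that footprint themselves. Dummies have no neighbours across, so the first
    spoils no point and the last is still undominated. *)
Lemma covn_cobip_closed k :
  covn m n inc k -> covn N N (closure cobip) (2 + k).
Proof.
case=> w [<- rw _ /andP[aw pw]].
pose f (p : nat * nat) := (p.1, m.+2 + p.2).
pose w' := (m, m) :: map f w ++ [:: (m.+2 + n, m.+2 + n)].
have -> : 2 + size w = size w' by rewrite /= size_cat size_map /= addn1.
have lr i j : i < m.+2 -> closure cobip i (m.+2 + j) = inc i j.
  move=> hi; rewrite closure_cobip_cross; last by lia.
  by rewrite cobip_lr ?addKn //; lia.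
apply: covn_intro; rewrite /w' /N.
  rewrite /= all_cat all_map /= andbT; apply/and3P; split; try lia.
  by apply: sub_all rw => p /=; lia.
rewrite /fpseq /= pairwise_cat /= !all_cat /= !all_map pairwise_map.
rewrite /= !andbT allrel1r all_map.
have rfl i : closure cobip i i by rewrite /closure eqxx.
rewrite !rfl lr ?incF //=; try lia; rewrite !andbT; apply/and4P; split.
- apply/allP => p pw'; have := allP rw p pw'; have := allP aw p pw' => /= h1 h2.
  by rewrite /= lr //; lia.
- by apply/allP => p pw' /=; rewrite lr ?incF // leqnn.
- apply/allP => p pw' /=; have := allP rw p pw' => /= h.
  by rewrite lr ?incF ?leqnn ?orbT //; lia.
- apply: (sub_in_pairwise _ rw pw) => p q /andP[h1 _] _ /=.
  by rewrite lr //; lia.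
Qed.

(** With open neighbourhoods each pair of dummies is used whole, the two footprinting each other,
    which accounts for the 4. *)
Lemma covn_cobip_open k : covn m n inc k -> covn N N cobip (4 + k).
Proof.
case=> w [<- rw _ /andP[aw pw]].
pose f (p : nat * nat) := (p.1, m.+2 + p.2).
pose w' := [:: (m, m.+1), (m.+1, m) & map f w ++
  [:: (m.+2 + n, m.+2 + n.+1); (m.+2 + n.+1, m.+2 + n)]].
have -> : 4 + size w = size w' by rewrite /= size_cat size_map /= addn2.
have lr i j : i < m.+2 -> cobip i (m.+2 + j) = inc i j.
  by move=> hi; rewrite cobip_lr ?addKn //; lia.
apply: covn_intro; rewrite /w' /N.
  rewrite /= all_cat all_map /=; apply/and4P; split; try lia.
  by apply: sub_all rw => p /=; lia.
have s1 : cobip m m.+1 by rewrite cobip_same; lia.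
have s2 : cobip m.+1 m by rewrite cobip_same; lia.
have s3 : cobip (m.+2 + n) (m.+2 + n.+1) by rewrite cobip_same; lia.
have s4 : cobip (m.+2 + n.+1) (m.+2 + n) by rewrite cobip_same; lia.
rewrite /fpseq /= pairwise_cat /= !all_cat /= !all_map pairwise_map.
rewrite s1 s2 s3 s4 !cobip_irr !lr ?incF ?leqnn ?leqnSn //=.
rewrite !andbT; apply/andP; split.
  apply/allP => p pw'; have := allP rw p pw'; have := allP aw p pw' => /= h1 h2.
  by rewrite /= lr //; lia.
apply/and4P; split.
- by apply/allP => p pw' /=; rewrite lr ?incF // leqnn.
- by apply/allP => p pw' /=; rewrite lr ?incF // leqnSn.
- apply/allrelP => _ q /mapP[p pw' ->]; have := allP rw p pw' => /= h.
  by rewrite !inE => /orP[]/eqP -> /=; rewrite lr ?incF //; lia.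
- apply: (sub_in_pairwise _ rw pw) => p q /andP[h1 _] _ /=.
  by rewrite lr //; lia.
Qed.

(* The second hypothesis says that [c] vertices of one clique dominate the whole clique.  So
   every sequence uses one of the cliques at most [c] times, and on the other one
   all but its first [c] vertices have their footprints across. *)
Lemma fpn_cobip_covn c (Q : nat -> nat -> bool) k :
  (forall a b, cobip a b -> Q a b) ->
  (forall (s : bool) (t : seq (nat * nat)) u, uniq (unzip1 t) ->
     all (fun p => (p.1 < m.+2) == s) t -> (u < m.+2) = s -> c <= size t ->
     has (fun p => Q p.1 u) t) ->
  fpn N N (closure cobip) Q (c.*2 + k) -> covn m n inc k.
Proof.
move=> hQ hdom [w [sw _ uw /andP[aw pw]]].
pose side s (p : nat * nat) := (p.1 < m.+2) == s.
have uf s (t : seq (nat * nat)) : uniq (unzip1 t) -> uniq (unzip1 (filter (side s) t)).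
  by apply: subseq_uniq; apply: map_subseq; apply: filter_subseq.
(* The last footprint lies in some clique and is still undominated there, so fewer than [c] vertices
   of that clique precede the last pair, hence at most [c] occur in all. *)
have [s hs] : exists s, size (filter (side (~~ s)) w) <= c.
  case/lastP: w uw pw {aw sw} => [|w z]; first by exists true.
  rewrite /unzip1 map_rcons rcons_uniq pairwise_rcons => /andP[_ uw] /andP[hz _].
  pose s0 := z.2 < m.+2; pose s1 := z.1 < m.+2.
  have hc : size (filter (side s0) w) < c.
    rewrite ltnNge; apply/negP => hc.
    have := hdom s0 _ z.2 (uf s0 w uw) (filter_all _ _) erefl hc.
    case/hasP => p; rewrite mem_filter => /andP[_ pw'] Qp.
    by have := allP hz p pw'; rewrite /= Qp.
  exists (~~ s0); rewrite negbK filter_rcons.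
  by case: (side s0 z); rewrite ?size_rcons; lia.
have sz : c + k <= size (filter (side s) w).
  have := count_predC (side s) w; rewrite -!size_filter sw.
  rewrite (eq_filter (a1 := predC (side s)) (a2 := side (~~ s))) => [|p].
    by move: hs; rewrite -addnn; lia.
  by rewrite /= /side; case: (_ < _); case: (s).
set t := filter (side s) w in sz.
(* After its first [c] chosen vertices the clique [s] is dominated, so later footprints must lie in
   the other clique. *)
have tail : all (fun p => (p.2 < m.+2) == ~~ s) (drop c t).
  apply/allP => p pt; case: eqP => // /eqP np.
  have ps : (p.2 < m.+2) = s by move: np; case: (_ < _); case: (s).
  have := hdom s (take c t) p.2.
  rewrite {1}/unzip1 map_take take_uniq ?uf //.
  have at_ : all (side s) t := filter_all _ _.
  move: (at_); rewrite -{1}(cat_take_drop c t) all_cat => /andP[-> _].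
  rewrite size_takel; last by lia.
  move=> /(_ isT erefl ps (leqnn c)) /hasP[q qt Qq].
  have : pairwise (fun p q => ~~ Q p.1 q.2) t by apply: pairwise_filter.
  rewrite -{1}(cat_take_drop c t) pairwise_cat => /and3P[/allrelP/(_ q p qt pt)].
  by rewrite Qq.
have hd p : p \in drop c t ->
    [/\ (p.1 < m.+2) = s, (p.2 < m.+2) = ~~ s & cobip p.1 p.2].
  move=> pt; have p2 := eqP (allP tail p pt); have := mem_drop pt.
  rewrite mem_filter => /andP[/eqP p1 pw']; split=> //.
  by rewrite -closure_cobip_cross ?(allP aw) // p1 p2; case: (s).
have pd : pairwise (fun p q => ~~ Q p.1 q.2) (drop c t).
  by apply: subseq_pairwise (drop_subseq _ _) _; apply: pairwise_filter.
have szd : k <= size (drop c t) by rewrite size_drop; lia.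
have hm : all (mem (drop c t)) (drop c t) by apply/allP.
case: s {hs uf tail} @t sz hd pd szd hm => t sz hd pd szd hm.
  (* On the edge side the chosen edges footprint points: a covering sequence as it stands. *)
  pose f (p : nat * nat) := (p.1, p.2 - m.+2).
  apply: (@fpn_leq _ _ _ _ _ (size (map f (drop c t)))); first by rewrite size_map.
  apply: covn_intro.
    rewrite all_map; apply/allP => p /hd[p1 /negbT p2]; rewrite -leqNgt in p2.
    by rewrite cobip_lr // => /inc_range.
  rewrite /fpseq all_map pairwise_map; apply/andP; split.
    apply/allP => p /hd[p1 /negbT p2]; rewrite -leqNgt in p2.
    by rewrite cobip_lr.
  apply: (sub_in_pairwise _ hm pd) => p q /hd[p1 _ _] /hd[_ /negbT q2 _].
  by rewrite -leqNgt in q2; apply: contra => h; apply: hQ; rewrite cobip_lr.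
(* incidence is self-dual: transpose and reverse *)
pose f (p : nat * nat) := (p.2, p.1 - m.+2).
apply: (@fpn_leq _ _ _ _ _ (size (rev (map f (drop c t))))).
  by rewrite size_rev size_map.
apply: covn_intro.
  rewrite all_rev all_map; apply/allP => p /hd[/negbT p1 p2].
  by rewrite -leqNgt in p1; rewrite cobip_rl // => /inc_range.
rewrite /fpseq pairwise_rev all_rev all_map pairwise_map; apply/andP; split.
  apply/allP => p /hd[/negbT p1 p2]; rewrite -leqNgt in p1.
  by rewrite cobip_rl.
(* An earlier point misses a later edge; after reversal the edge comes first and leaves that point
   uncovered. *)
apply: (sub_in_pairwise _ hm pd) => p q /hd[/negbT p1 _ _] /hd[_ q2 _].
by rewrite -leqNgt in p1; apply: contra => h; apply: hQ; rewrite cobip_rl.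
Qed.

Lemma closed_dom (s : bool) (t : seq (nat * nat)) u :
  uniq (unzip1 t) -> all (fun p => (p.1 < m.+2) == s) t -> (u < m.+2) = s ->
  1 <= size t -> has (fun p => closure cobip p.1 u) t.
Proof.
case: t => //= p t _ /andP[/eqP ps _] us _.
by rewrite /closure cobip_same ?orbN // us.
Qed.

(** A clique vertex fails to be adjacent only to itself, and [u] cannot equal both of two distinct
    vertices. *)
Lemma open_dom (s : bool) (t : seq (nat * nat)) u :
  uniq (unzip1 t) -> all (fun p => (p.1 < m.+2) == s) t -> (u < m.+2) = s ->
  2 <= size t -> has (fun p => cobip p.1 u) t.
Proof.
case: t => [|p [|q t]] //= /andP[npq _] /and3P[/eqP ps /eqP qs _] us _.
rewrite !cobip_same ?us //; move: npq; rewrite inE negb_or => /andP[npq _].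
by case: eqP => //= pu; rewrite -pu eq_sym npq.
Qed.

Lemma closed_cobipE k : covn m n inc k <-> covn N N (closure cobip) (2 + k).
Proof.
split; first exact: covn_cobip_closed.
by apply: (fpn_cobip_covn (c := 1)) closed_dom => a b h; rewrite /closure h orbT.
Qed.

(** Every total dominating sequence is an L-sequence. This gives the forward direction here, and the
    backward direction of [open_cobipE] from this lemma. *)
Lemma L_cobipE k : covn m n inc k <-> fpn N N (closure cobip) cobip (4 + k).
Proof.
split; last by apply: (fpn_cobip_covn (c := 2)) open_dom.
move/covn_cobip_open; apply: fpn_sub_in => // i j _ _ h.
by rewrite /closure h orbT.
Qed.

Lemma open_cobipE k : covn m n inc k <-> covn N N cobip (4 + k).
Proof.
split; first exact: covn_cobip_open.
move=> h; apply/L_cobipE; apply: fpn_sub_in h => // i j _ _ h.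
by rewrite /closure h orbT.
Qed.

Definition incidence_graph a b : bool :=
  if a < m then (m <= b) && inc a (b - m) else (b < m) && inc b (a - m).

Lemma incidence_graph_sym a b : incidence_graph a b = incidence_graph b a.
Proof. by rewrite /incidence_graph; case: (ltnP a m); case: (ltnP b m). Qed.

Lemma incidence_graph_cross a b : incidence_graph a b -> (a < m) != (b < m).
Proof. by rewrite /incidence_graph; case: (ltnP a m); case: (ltnP b m). Qed.

Lemma incidence_graph_irr a : incidence_graph a a = false.
Proof. by rewrite /incidence_graph; case: (ltnP a m). Qed.

(** In the bipartite incidence graph the open neighbourhood of an edge vertex is the set of its
    points, shifted by [m]. *)
Lemma incidence_graphE k : covn m n inc k <->
  covn (m + n) (m + n) (fun a b => (a < m) && incidence_graph a b) k.
Proof.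
rewrite /incidence_graph; split=> -[w [<- rw _ /andP[aw pw]]].
  pose f (p : nat * nat) := (p.1, m + p.2).
  rewrite -(size_map f); apply: covn_intro.
    by rewrite all_map; apply: sub_all rw => p /=; lia.
  rewrite /fpseq all_map pairwise_map; apply/andP; split.
    apply: sub_all aw => p /= h; have /andP[h1 _] := inc_range h.
    by rewrite h1 leq_addr addKn h.
  by apply: sub_pairwise pw => p q /=; apply: contra => /andP[->]; rewrite leq_addr addKn.
pose f (p : nat * nat) := (p.1, p.2 - m).
have {}aw : all (fun p => [&& p.1 < m, m <= p.2 & inc p.1 (p.2 - m)]) w.
  by apply: sub_all aw => p /= /andP[->].
rewrite -(size_map f); apply: covn_intro.
  by rewrite all_map; apply: sub_all aw => p /and3P[_ _ /inc_range].
rewrite /fpseq all_map pairwise_map; apply/andP; split.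
  by apply: sub_all aw => p /and3P[].
apply: (sub_in_pairwise _ aw pw) => p q /and3P[h1 _ _] /and3P[_ h2 _] /=.
by rewrite h1 h2.
Qed.

End CoBipartite.

(** * The reductions *)

Lemma size_mkmat r c e : size (mkmat r c e) = r.
Proof. by rewrite size_map size_iota. Qed.

Lemma nth_mkmat r c e i : i < r ->
  nth [::] (mkmat r c e) i = [seq e i j | j <- iota 0 c].
Proof. by move=> lti; rewrite (nth_map 0) ?size_iota // nth_iota. Qed.

Lemma bit_mkmat r c e i j : i < r -> j < c -> bit (mkmat r c e) i j = e i j.
Proof.
by move=> lti ltj; rewrite /bit nth_mkmat // (nth_map 0) ?size_iota // nth_iota.
Qed.

Lemma rowsize_mkmat r c e i : i < r -> rowsize (mkmat r c e) i = c.
Proof. by move=> lti; rewrite /rowsize nth_mkmat // size_map size_iota. Qed.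

Lemma behead_mkmat r c e : behead (mkmat r.+1 c e) = mkmat r c (fun i => e i.+1).
Proof. by rewrite /mkmat /= (iotaDl 1 0) -map_comp. Qed.

Lemma valid_graph_mkmat n e : symmetric e -> (forall i, e i i = false) ->
  valid_graph (mkmat n n e).
Proof.
move=> sym irr; apply/all_belowP => i; rewrite size_mkmat => lti.
rewrite rowsize_mkmat // eqxx bit_mkmat // irr; apply/all_belowP => j ltj.
by rewrite !bit_mkmat // sym.
Qed.

Lemma valid_graph_irr R i : valid_graph R -> ~~ bit R i i.
Proof.
move/all_belowP=> h; case: (ltnP i (size R)) => [/h/and3P[]//|lei].
by rewrite /bit (nth_default _ lei) nth_nil.
Qed.

(** Entries out of range read as [false]; this supplies the hypothesis [inc_range] of the
    constructions. *)
Lemma valid_hypergraph_range R i j : valid_hypergraph R -> bit R i.+1 j ->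
  (i < (size R).-1) && (j < rowsize R 0).
Proof.
case/and3P=> _ _ /all_belowP h; case: (ltnP i.+1 (size R)) => [lti|lei].
  rewrite -(eqP (h _ lti)) /bit /rowsize; case: (ltnP j) => [_ _|lej].
    by rewrite andbT; case: (size R) lti.
  by rewrite nth_default.
by rewrite /bit (nth_default [::] lei) nth_nil.
Qed.

(** Nonempty encodings end in a separator, which makes a lone bit a no-instance of every problem
    here. *)
Lemma bad_word_graph (Phi : forall n, sgraph 'I_n -> Prop) :
  ~ exists n (G : sgraph 'I_n), [:: Bit true] = enc_graph G /\ Phi n G.
Proof.
by move/graph_problem_valid => [R eR _]; have := wf_enc_rows R; rewrite -eR.
Qed.

Lemma bad_word_covering k : ~ grundy_covering_in_hypergraphs [:: Bit true] k.
Proof.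
by move/grundy_covering_valid => [R eR _]; have := wf_enc_rows R; rewrite -eR.
Qed.

Lemma bad_word_one_sided k : ~ one_sided_grundy_total_domination [:: Bit true] k.
Proof.
by move/one_sided_valid => [R eR _]; have := wf_enc_rows R; rewrite -eR.
Qed.

(** * Running times of the validity tests *)

Ltac ptime_step := lazymatch goal with
  | |- bptime (fun d => @?P d && @?Q d) => apply: bptime_and
  | |- bptime (fun d => @?P d || @?Q d) => apply: bptime_or
  | |- bptime (fun d => ~~ @?P d) => apply: bptime_neg
  | |- bptime (fun d => @?P d ==> @?Q d) => apply: bptime_imply
  | |- bptime (fun d => @?f d <= @?g d) => apply: bptime_leq
  | |- bptime (fun d => @?f d == @?g d) =>
      first [apply: bptime_eqn | apply: bptime_eqb]
  | |- bptime (fun d => all_below (@?n d) _) => apply: bptime_all_iota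
  | |- bptime (fun d => bit (rows_of (@?M d)) (@?i d) (@?j d)) => apply: bptime_bit
  | |- bptime _ => first [apply: bptime_const | apply: bptime_if]
  | |- nptime (fun d => (@?f d).+1) => apply: nptime_succ
  | |- nptime (fun d => @?f d + @?g d) => apply: nptime_add
  | |- nptime (fun d => @?f d - @?g d) => apply: nptime_sub
  | |- nptime (fun d => tsz (@?F d)) => apply: nptime_tsz
  | |- nptime (fun d => size (rows_of (@?F d))) => apply: nptime_size_rows
  | |- nptime (fun d => rowsize (rows_of (@?F d)) (@?i d)) => apply: nptime_rowsize
  | |- nptime _ => apply: nptime_const
  | |- ptime (fun d => thead (@?F d)) => apply: ptime_thead
  | |- ptime (fun d => ttail (@?F d)) => apply: ptime_ttail
  | |- ptime thead => exact: ptime_thead ptime_id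
  | |- ptime ttail => exact: ptime_ttail ptime_id
  | |- ptime _ => apply: ptime_id
  end.

Lemma bptime_valid_graph M : ptime M ->
  bptime (fun d => valid_graph (rows_of (M d))).
Proof.
move=> pM; apply: (ptime_comp (G := fun d => tbool (valid_graph (rows_of d)))) pM.
rewrite /valid_graph -/(bptime _); repeat ptime_step.
Qed.

Lemma bptime_valid_bigraph : bptime (fun d => valid_bigraph (rows_of d)).
Proof.
(* Dropping a row is taking the tail of the tree, an operation known to be polynomial. *)
have bh d : behead (rows_of d) = rows_of (ttail d) by case: d.
pose V d := [&& 0 < size (rows_of d), valid_graph (rows_of (ttail d)),
  rowsize (rows_of d) 0 == size (rows_of (ttail d)) &
  all_below (size (rows_of (ttail d))) (fun i =>
    all_below (size (rows_of (ttail d))) (fun j =>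
      bit (rows_of (ttail d)) i j ==> (bit (rows_of d) 0 i != bit (rows_of d) 0 j)))].
apply: (@ptime_ext (fun d => tbool (V d))) => [d|].
  by rewrite /V /valid_bigraph !bh.
rewrite /V -/(bptime _); repeat first
  [exact: bptime_valid_graph (ptime_ttail ptime_id) | ptime_step].
Qed.

Lemma bptime_valid_hypergraph : bptime (fun d => valid_hypergraph (rows_of d)).
Proof. rewrite /valid_hypergraph; repeat ptime_step. Qed.

(* The index [i - 1] skips the first row, which encodes the ground set. *)
Lemma reduction_to_covering (L : pproblem) (V : seq (seq bool) -> bool)
    (r c : seq (seq bool) -> nat) (E : seq (seq bool) -> nat -> nat -> bool) :
  bptime (fun d => V (rows_of d)) ->
  nptime (fun d => r (rows_of d)) -> nptime (fun d => c (rows_of d)) ->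
  bptime (fun x => E (rows_of (ttail (ttail x))) (tsz (thead (ttail x)) - 1)
                     (tsz (thead x))) ->
  (forall x k, L x k -> exists2 R, x = enc_rows R & V R) ->
  (forall R k, V R -> L (enc_rows R) k <-> covn (r R) (c R) (E R) k) ->
  poly_reducible L grundy_covering_in_hypergraphs.
Proof.
move=> pV pr pc pE hV hL.
apply: (@matrix_reduction _ _ V (fun R => (r R).+1) c
  (fun R i j => (i == 0) || E R (i - 1) j) 0) => //.
- exact: nptime_succ.
- by apply: bptime_or pE; repeat ptime_step.
- exact: bad_word_covering.
move=> R k VR; set M := mkmat _ _ _.
have sM : size M = (r R).+1 by rewrite size_mkmat.
have s0 : rowsize M 0 = c R by rewrite rowsize_mkmat.
have vM : valid_hypergraph M.
  apply/and3P; split; rewrite ?sM ?s0 //; apply/all_belowP => i lti.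
    by rewrite bit_mkmat.
  by rewrite rowsize_mkmat.
rewrite hL // add0n grundy_coveringE // sM s0; apply: covn_eq_in => i j lti ltj.
by rewrite bit_mkmat //= subn1.
Qed.

(** Shared by the three two-clique reductions: [Psi] is the matrix form of the target problem and
    [a] the shift of the parameter. [Psi] may depend only on entries in range, the only ones that
    the output matrix reproduces. *)
Lemma covering_to_graph (L : pproblem) a
    (Psi : nat -> (nat -> nat -> bool) -> nat -> Prop) :
  (forall k, ~ L [:: Bit true] k) ->
  (forall R k, valid_graph R -> L (enc_rows R) k <-> Psi (size R) (bit R) k) ->
  (forall n b b' k, (forall i j, i < n -> j < n -> b i j = b' i j) ->
     Psi n b k <-> Psi n b' k) ->
  (forall m n (inc : nat -> nat -> bool) k, (forall i j, inc i j -> (i < m) && (j < n)) ->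
     covn m n inc k <-> Psi (m.+2 + n.+2) (cobip m inc) (a + k)) ->
  poly_reducible grundy_covering_in_hypergraphs L.
Proof.
move=> bad hL ext hPsi; pose s R := (size R - 1).+2 + (rowsize R 0).+2.
apply: (@matrix_reduction _ _ valid_hypergraph s s
  (fun R => cobip (size R - 1) (fun i j => bit R i.+1 j)) a) => //.
- exact: bptime_valid_hypergraph.
- by rewrite /s; repeat ptime_step.
- by rewrite /s; repeat ptime_step.
- by rewrite /cobip; repeat ptime_step.
- by move=> x k; apply: grundy_covering_valid.
move=> R k vR; rewrite grundy_coveringE // (hPsi _ _ _ k (fun i j =>
  @valid_hypergraph_range R i j vR)) hL; last first.
  by apply: valid_graph_mkmat => [i j|i]; [exact: cobip_sym | exact: cobip_irr].
rewrite size_mkmat /s subn1; apply: ext => i j lti ltj.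
by rewrite bit_mkmat // subn1.
Qed.

(** * Reductions into Grundy covering *)

Lemma domination_to_covering :
  poly_reducible grundy_domination grundy_covering_in_hypergraphs.
Proof.
apply: (@reduction_to_covering _ valid_graph size size (fun R => closure (bit R))).
- exact: bptime_valid_graph ptime_id.
- exact: nptime_size_rows ptime_id.
- exact: nptime_size_rows ptime_id.
- by rewrite /closure; repeat ptime_step.
- by move=> x k; apply: graph_problem_valid.
- by move=> R k vR; apply: grundy_dominationE.
Qed.

Lemma total_to_covering :
  poly_reducible total_grundy_domination grundy_covering_in_hypergraphs.
Proof.
apply: (@reduction_to_covering _ valid_graph size size bit).
- exact: bptime_valid_graph ptime_id.
- exact: nptime_size_rows ptime_id.
- exact: nptime_size_rows ptime_id.
- by repeat ptime_step.
- by move=> x k; apply: graph_problem_valid.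
- by move=> R k vR; apply: total_grundy_dominationE.
Qed.

Lemma L_to_covering :
  poly_reducible L_grundy_domination grundy_covering_in_hypergraphs.
Proof.
apply: (@reduction_to_covering _ valid_graph size (fun R => size R + size R)
  (fun R => L_incidence (size R) (bit R))).
- exact: bptime_valid_graph ptime_id.
- exact: nptime_size_rows ptime_id.
- by repeat ptime_step.
- by rewrite /L_incidence /closure; repeat ptime_step.
- by move=> x k; apply: graph_problem_valid.
- move=> R k vR; rewrite L_grundy_dominationE //.
  by apply: L_fpn_covn => i; apply: valid_graph_irr.
Qed.

Lemma one_sided_to_covering :
  poly_reducible one_sided_grundy_total_domination grundy_covering_in_hypergraphs.
Proof.
apply: (@reduction_to_covering _ valid_bigraph (fun R => size R - 1)
  (fun R => size R - 1) (fun R i j => bit R 0 i && bit R i.+1 j)).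
- exact: bptime_valid_bigraph.
- by repeat ptime_step.
- by repeat ptime_step.
- by repeat ptime_step.
- by move=> x k; apply: one_sided_valid.
- by move=> R k vR; rewrite subn1; apply: one_sidedE.
Qed.

(** * Reductions out of Grundy covering *)

Lemma covering_to_domination :
  poly_reducible grundy_covering_in_hypergraphs grundy_domination.
Proof.
apply: (@covering_to_graph _ 2 (fun n b => covn n n (closure b))).
- by move=> k; apply: bad_word_graph.
- by move=> R k; apply: grundy_dominationE.
- by move=> n b b' k h; apply: covn_eq_in => i j li lj; rewrite /closure h.
- by move=> m n inc k h; apply: closed_cobipE.
Qed.

Lemma covering_to_total :
  poly_reducible grundy_covering_in_hypergraphs total_grundy_domination.
Proof.
apply: (@covering_to_graph _ 4 (fun n b => covn n n b)).
- by move=> k; apply: bad_word_graph.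
- by move=> R k; apply: total_grundy_dominationE.
- by move=> n b b' k h; apply: covn_eq_in.
- by move=> m n inc k h; apply: open_cobipE.
Qed.

Lemma covering_to_L :
  poly_reducible grundy_covering_in_hypergraphs L_grundy_domination.
Proof.
apply: (@covering_to_graph _ 4 (fun n b => fpn n n (closure b) b)).
- by move=> k; apply: bad_word_graph.
- by move=> R k; apply: L_grundy_dominationE.
- move=> n b b' k h.
  by split; apply: fpn_sub_in => i j li lj; rewrite /closure h.
- by move=> m n inc k h; apply: L_cobipE.
Qed.

Lemma covering_to_one_sided :
  poly_reducible grundy_covering_in_hypergraphs one_sided_grundy_total_domination.
Proof.
pose m R := size R - 1; pose s R := m R + rowsize R 0.
pose g R := incidence_graph (m R) (fun i j => bit R i.+1 j).
(* Row 0 declares the edge vertices to be the side [A]; the incidence graph follows from row 1 on,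
   hence the index [i - 1]. *)
apply: (@matrix_reduction _ _ valid_hypergraph (fun R => (s R).+1) s
  (fun R i j => if i == 0 then j < m R else g R (i - 1) j) 0) => //.
- exact: bptime_valid_hypergraph.
- by rewrite /s /m; repeat ptime_step.
- by rewrite /s /m; repeat ptime_step.
- by rewrite /g /m /incidence_graph; repeat ptime_step.
- by move=> x k; apply: grundy_covering_valid.
- exact: bad_word_one_sided.
move=> R k vR; set M := mkmat _ _ _.
have sM : size M = (s R).+1 by rewrite size_mkmat.
have bM : behead M = mkmat (s R) (s R) (g R).
  rewrite /M behead_mkmat /mkmat; apply: eq_map => i; apply: eq_map => j.
  by rewrite /= subn1.
have vM : valid_bigraph M.
  apply/and4P; split; rewrite ?sM // bM ?size_mkmat ?rowsize_mkmat //.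
    by apply: valid_graph_mkmat => [i j|i];
      [exact: incidence_graph_sym | exact: incidence_graph_irr].
  apply/all_belowP => i lti; apply/all_belowP => j ltj.
  rewrite !bit_mkmat //=; apply/implyP; exact: incidence_graph_cross.
rewrite grundy_coveringE // (incidence_graphE (fun i j =>
  @valid_hypergraph_range R i j vR)) add0n one_sidedE // sM /s /m subn1.
apply: covn_eq_in => i j lti ltj.
by rewrite !bit_mkmat /s /m ?subn1 //= /g /m subn1.
Qed.

Theorem theorem18 (P Q : problem_name) :
  fpt_reducible (problem P) (problem Q).
Proof.
apply: poly_fpt_reducible.
apply: (@poly_reducible_trans _ grundy_covering_in_hypergraphs).
  case: P; [exact: domination_to_covering | exact: total_to_covering |
    exact: one_sided_to_covering | exact: L_to_covering | exact: poly_reducible_refl].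
case: Q; [exact: covering_to_domination | exact: covering_to_total |
  exact: covering_to_one_sided | exact: covering_to_L | exact: poly_reducible_refl].
Qed.
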